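(* Assume $G=([n],E)$ is a graph with no critical edges. Then the following holds. (i) $f_G^{(r)}=\frac{1}{\alpha(G)}$ for some $r\in\mathbb{N}$. (ii) $\vartheta^{(r)}(G)=\alpha(G)$ for some $r\in\mathbb{N}$.
   Context: Graphs are finite and simple. $\alpha(G)$ is the maximum cardinality of a stable set of $G$. An edge $e$ of $G$ is critical if $\alpha(G\setminus e)=\alpha(G)+1$, where $G\setminus e$ is obtained by deleting the edge $e$. $A_G$ is the adjacency matrix of $G$, $I$ the identity matrix, $J$ the all-ones matrix, and $f_G(x)=x^T(I+A_G)x$. $\Sigma$ is the set of sums of squares of real polynomials in $x=(x_1,\dots,x_n)$. The truncated quadratic module is $\mathcal{M}(x_1,\dots,x_n)_r=\{\sigma_0+\sum_{j=1}^n\sigma_jx_j:\sigma_j\in\Sigma,\ \deg(\sigma_0)\le 2r,\ \deg(\sigma_jx_j)\le 2r\}$, and the truncated ideal is $\langle h\rangle_{k}=\{uh:u\in\mathbb{R}[x],\deg(uh)\le k\}$. For $r\ge 1$, $$f_G^{(r)}=\sup\Big\{\lambda\in\mathbb{R}:f_G-\lambda\in\mathcal{M}(x_1,\dots,x_n)_r+\Big\langle1-\sum_{i=1}^nx_i\Big\rangle_{2r}\Big\}$$ (with $\sup\emptyset=-\infty$). For $r\ge0$, $\mathcal{K}^{(r)}_n$ is the set of real symmetric $n\times n$ matrices $M$ such that $(\sum_{i=1}^nx_i^2)^r\sum_{i,j}M_{ij}x_i^2x_j^2\in\Sigma$, and $\vartheta^{(r)}(G)=\min\{t\in\mathbb{R}:t(I+A_G)-J\in\mathcal{K}_n^{(r)}\}$.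 *)

(* Defs.v *)
(* multinomials' [mpoly] has to be imported before [ereal]: in the other order
   their notations clash. *)
From HB Require Import structures.
From mathcomp Require Import all_boot all_order all_algebra.
From mathcomp Require Import mpoly.
From mathcomp Require Import boolp classical_sets reals constructive_ereal ereal.

Set Implicit Arguments.
Unset Strict Implicit.
Unset Printing Implicit Defensive.

Import Order.TTheory GRing.Theory Num.Theory.

Local Open Scope classical_set_scope.
Local Open Scope ring_scope.

(* [symmetric] is qualified because [mpoly] shadows it with the predicate of
   symmetric polynomials. *)
Definition simple_graph n (e : rel 'I_n) : Prop :=
  ssrbool.symmetric e /\ irreflexive e.

Definition stable n (e : rel 'I_n) (S : {set 'I_n}) : bool :=
  [forall i in S, forall j in S, ~~ e i j].

Definition alpha n (e : rel 'I_n) : nat :=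
  (\max_(S : {set 'I_n} | stable e S) #|S|)%N.

Definition del_edge n (e : rel 'I_n) (i j : 'I_n) : rel 'I_n :=
  fun u v => e u v && ([set u; v] != [set i; j])%SET.

Definition critical_edge n (e : rel 'I_n) (i j : 'I_n) : bool :=
  e i j && (alpha (del_edge e i j) == (alpha e).+1).

Definition adjacency (R : realType) n (e : rel 'I_n) : 'M[R]_n :=
  \matrix_(i, j) (e i j)%:R.

(* [msize 0 = 0], so the zero polynomial has degree at most [k] for all [k]. *)
Definition deg_le (R : realType) n (k : nat) (p : {mpoly R[n]}) : bool :=
  (msize p <= k.+1)%N.

Definition sos (R : realType) n : set {mpoly R[n]} :=
  [set p | exists s : seq {mpoly R[n]}, p = \sum_(q <- s) q ^+ 2].

Definition trunc_qmodule (R : realType) n (r : nat) : set {mpoly R[n]} :=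
  [set p | exists (s0 : {mpoly R[n]}) (s : 'I_n -> {mpoly R[n]}),
     [/\ @sos R n s0 /\ (forall j, @sos R n (s j)),
         deg_le (2 * r) s0,
         forall j, deg_le (2 * r) (s j * 'X_j)
       & p = s0 + \sum_(j < n) s j * 'X_j]].

Definition trunc_ideal (R : realType) n (h : {mpoly R[n]}) (k : nat) :
    set {mpoly R[n]} :=
  [set p | exists2 u : {mpoly R[n]}, deg_le k (u * h) & p = u * h].

Definition graph_poly (R : realType) n (e : rel 'I_n) : {mpoly R[n]} :=
  \sum_(i < n) \sum_(j < n) (1%:M + adjacency R e) i j *: ('X_i * 'X_j).

(* The supremum is taken in the extended reals, where [ereal_sup set0 = -oo]. *)
Definition f_bound (R : realType) n (e : rel 'I_n) (r : nat) : \bar R :=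
  ereal_sup [set l%:E | l in
    [set l : R | exists p q : {mpoly R[n]},
       [/\ @trunc_qmodule R n r p,
           trunc_ideal (1 - \sum_(i < n) 'X_i) (2 * r) q
         & graph_poly R e - l%:MP = p + q]]].

Definition cone_K (R : realType) n (r : nat) : set 'M[R]_n :=
  [set M | M^T = M /\
     @sos R n ((\sum_(i < n) 'X_i ^+ 2) ^+ r *
       \sum_(i < n) \sum_(j < n) M i j *: ('X_i ^+ 2 * 'X_j ^+ 2))].

Definition is_min (R : realType) (A : set R) (t : R) : Prop :=
  A t /\ lbound A t.

(* [theta_eq e r t] is the equation "theta^(r)(G) = t"; it includes the
   attainment of the minimum that defines theta^(r)(G). *)
Definition theta_eq (R : realType) n (e : rel 'I_n) (r : nat) (t : R) : Prop :=
  is_min [set u : R |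
    @cone_K R n r (u *: (1%:M + adjacency R e) - const_mx 1)] t.

(* Main.v *)
(** The point x^S (uniform on a maximum stable set S) is a zero of f = f_G - 1/alpha
on the simplex, and by Motzkin-Straus there are no other zeros when G has no
critical edge: every vertex outside S then has at least two neighbours in S.
Expanding f at x^S modulo 1 - sum x_i, with D_S the squared distance to x^S, gives
f = D_S + sum_(i notin S) x_i l_i with l_i affine and l_i(x^S) > 0; as l_i + K D_S is
a sum of squares, f = m + D_S k with m in the quadratic module Q of the simplex and
k(x^S) > 0.

These local certificates are glued. Let W be the product of the D_S, and W_S the
product of the others. For u = sum_S c_S W_S^2 + K W one finds u f = m + W h with m
in Q and h > 0 on the simplex. After normalization, u = 1 at the zeros and
0 < u < 2 on the simplex; with p = 1 - u one writes
f = (1 - p^(2m+1)) f + p^(2m+1) f = (1 + p + ... + p^2m) u f + p^(2m+1) f.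
The geometric sum is a sum of squares bounded below by 1/2, and the last term is
minus a small multiple of W, up to sums of squares. So f is in Q up to W times a
polynomial that is positive on the simplex, and the latter is in Q by Putinar's
theorem. Putinar's theorem, and the compactness arguments, are obtained
from maximal quadratic modules. Finally (ii) follows from the certificate by
the substitution x_i := x_i^2 / sum x_j^2 and clearing denominators. *)

Require Import Defs.
From HB Require Import structures.
From mathcomp Require Import all_boot all_order all_algebra.
From mathcomp Require Import mpoly.
From mathcomp Require Import boolp classical_sets reals constructive_ereal ereal.
From mathcomp Require Import ring lra.

Set Implicit Arguments.
Unset Strict Implicit.
Unset Printing Implicit Defensive.

Import Order.TTheory GRing.Theory Num.Theory.

Local Open Scope ring_scope.

(** * Archimedean quadratic modules *)

Section PolynomialCones.

Variables (R : realType) (n : nat).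
Implicit Types (p q h s : {mpoly R[n]}) (v : 'I_n -> R).

Lemma mpoly_ring_ind (P : {mpoly R[n]} -> Prop) :
  (forall c : R, P c%:MP) -> (forall i, P 'X_i) ->
  (forall p q, P p -> P q -> P (p + q)) ->
  (forall p q, P p -> P q -> P (p * q)) -> forall p, P p.
Proof.
move=> PC PX PD PM; elim/mpolyind => [|c m p _ _ Pp]; first by rewrite -mpolyC0.
apply: (PD) => //; rewrite -mul_mpolyC; apply: (PM) => //.
rewrite mpolyXE_id; apply: (big_ind P) => // [|i _]; first by rewrite -mpolyC1.
by elim: (m i) => [|k IH]; rewrite ?expr0 -?mpolyC1 // exprS; apply: PM.
Qed.

Lemma sos0 : @sos R n 0.
Proof. by exists [::]; rewrite big_nil. Qed.

Lemma sosD p q : sos p -> sos q -> sos (p + q).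
Proof. by move=> [s ->] [t ->]; exists (s ++ t); rewrite big_cat. Qed.

Lemma sos_sqr p : sos (p ^+ 2).
Proof. by exists [:: p]; rewrite big_seq1. Qed.

Lemma sos_sum (I : Type) (r : seq I) (P : pred I) (F : I -> {mpoly R[n]}) :
  (forall i, P i -> sos (F i)) -> sos (\sum_(i <- r | P i) F i).
Proof. by move=> sF; apply: (big_ind (@sos R n)) sF; [apply: sos0|apply: sosD]. Qed.

Lemma sosM p q : sos p -> sos q -> sos (p * q).
Proof.
move=> [s ->] [t ->]; rewrite mulr_suml; apply: sos_sum => a _.
by rewrite mulr_sumr; apply: sos_sum => b _; rewrite -exprMn; apply: sos_sqr.
Qed.

Lemma sosC (c : R) : 0 <= c -> sos (c%:MP : {mpoly R[n]}).
Proof. by move=> c0; rewrite -(sqr_sqrtr c0) rmorphXn; apply: sos_sqr. Qed.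

Lemma sos1 : @sos R n 1.
Proof. by rewrite -(expr1n _ 2); apply: sos_sqr. Qed.

Lemma sosX p k : sos p -> sos (p ^+ k).
Proof.
by move=> sp; elim: k => [|k IH]; rewrite ?expr0 ?exprS; [apply: sos1|apply: sosM].
Qed.

Lemma sos_prod (I : Type) (r : seq I) (P : pred I) (F : I -> {mpoly R[n]}) :
  (forall i, P i -> sos (F i)) -> sos (\prod_(i <- r | P i) F i).
Proof. by move=> sF; apply: (big_ind (@sos R n)) sF; [apply: sos1|apply: sosM]. Qed.

Lemma sos_ge0 p v : sos p -> 0 <= p.@[v].
Proof.
move=> [s ->]; rewrite rmorph_sum /=; apply: sumr_ge0 => q _.
by rewrite rmorphXn; apply: sqr_ge0.
Qed.

Definition quadratic_module (Q : set {mpoly R[n]}) : Prop :=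
  [/\ Q 1, forall p q, Q p -> Q q -> Q (p + q)
    & forall p q, Q q -> Q (p ^+ 2 * q)].

(** Applied to [p] and to its negative, this bounds every polynomial from both sides. *)
Definition archimedean (Q : set {mpoly R[n]}) : Prop :=
  forall p, exists N : R, Q (N%:MP - p).

Definition positivity_set (Q : set {mpoly R[n]}) : set ('I_n -> R) :=
  [set v | forall q, Q q -> 0 <= q.@[v]].

Section QuadraticModule.

Variable Q : set {mpoly R[n]}.
Hypothesis qmQ : quadratic_module Q.

Lemma qm0 : Q 0.
Proof. by case: qmQ => Q1 _ QM; have := QM 0 _ Q1; rewrite mulr1 expr0n. Qed.

Lemma qmD p q : Q p -> Q q -> Q (p + q).
Proof. by case: qmQ => _ QD _; apply: QD. Qed.

Lemma qm_sum (I : Type) (r : seq I) (P : pred I) (F : I -> {mpoly R[n]}) :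
  (forall i, P i -> Q (F i)) -> Q (\sum_(i <- r | P i) F i).
Proof. by move=> QF; apply: (big_ind Q) QF; [apply: qm0|apply: qmD]. Qed.

Lemma qm_sosM s q : sos s -> Q q -> Q (s * q).
Proof.
move=> [t ->] Qq; rewrite mulr_suml; apply: qm_sum => a _.
by case: qmQ => _ _; apply.
Qed.

Lemma qm_sos s : sos s -> Q s.
Proof. by move=> ss; rewrite -(mulr1 s); apply: qm_sosM => //; case: qmQ. Qed.

Lemma qmZ (c : R) q : 0 <= c -> Q q -> Q (c%:MP * q).
Proof. by move=> c0; apply/qm_sosM/sosC. Qed.

Lemma qmC (c : R) : 0 <= c -> Q c%:MP.
Proof. by move=> c0; apply/qm_sos/sosC. Qed.

Lemma qmZ_inv (c : R) q : 0 < c -> Q (c%:MP * q) -> Q q.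
Proof.
move=> c0 Qcq; suff -> : q = c^-1%:MP * (c%:MP * q).
  by apply: qmZ => //; rewrite invr_ge0 ltW.
by rewrite mulrA -mpolyCM mulVf ?gt_eqF // mpolyC1 mul1r.
Qed.

(** A quadratic module need not contain the product of [N - p] and [N + p]; weighting each of them
    by the square of the other gives [2 N] times that product. *)
Lemma qm_bounded_sqr (N : R) p : 0 < N ->
  Q (N%:MP - p) -> Q (N%:MP + p) -> Q ((N ^+ 2)%:MP - p ^+ 2).
Proof.
move=> N0 Qm Qp; apply: (@qmZ_inv (2 * N)); first by rewrite mulr_gt0.
have -> : (2 * N)%:MP * ((N ^+ 2)%:MP - p ^+ 2) =
   (N%:MP + p) ^+ 2 * (N%:MP - p) + (N%:MP - p) ^+ 2 * (N%:MP + p).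
  by ring.
by case: qmQ => _ QD QM; apply: QD; apply: QM.
Qed.

End QuadraticModule.

Definition qm_bounded (Q : set {mpoly R[n]}) : set {mpoly R[n]} :=
  [set p | exists N : R, [/\ 0 < N, Q (N%:MP - p) & Q (N%:MP + p)]].

Section Bounded.

Variable Q : set {mpoly R[n]}.
Hypothesis qmQ : quadratic_module Q.

Lemma qm_boundedC (c : R) : qm_bounded Q c%:MP.
Proof.
exists (`|c| + 1); split; first by rewrite ltr_wpDl.
- rewrite -mpolyCB; apply: (qmC qmQ); have := ler_norm c; lra.
- rewrite -mpolyCD; apply: (qmC qmQ); have := ler_norm (- c); rewrite normrN; lra.
Qed.

Lemma qm_boundedD p q : qm_bounded Q p -> qm_bounded Q q -> qm_bounded Q (p + q).
Proof.
move=> [N [N0 ? ?]] [M [M0 ? ?]]; exists (N + M); split; first exact: addr_gt0.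
- have -> : (N + M)%:MP - (p + q) = (N%:MP - p) + (M%:MP - q) by ring.
  exact: (qmD qmQ).
- have -> : (N + M)%:MP + (p + q) = (N%:MP + p) + (M%:MP + q) by ring.
  exact: (qmD qmQ).
Qed.

Lemma qm_boundedZ (c : R) p : qm_bounded Q p -> qm_bounded Q (c%:MP * p).
Proof.
move=> [N [N0 Nm Np]]; have [c0|c0] := leP 0 c.
  exists (c * N + 1); split; first by rewrite ltr_wpDl // mulr_ge0 // ltW.
  - have -> : (c * N + 1)%:MP - c%:MP * p = c%:MP * (N%:MP - p) + 1%:MP by ring.
    by apply: (qmD qmQ); [apply: (qmZ qmQ)|apply: (qmC qmQ)].
  - have -> : (c * N + 1)%:MP + c%:MP * p = c%:MP * (N%:MP + p) + 1%:MP by ring.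
    by apply: (qmD qmQ); [apply: (qmZ qmQ)|apply: (qmC qmQ)].
have {}c0 : 0 <= - c by rewrite oppr_ge0 ltW.
exists (- c * N + 1); split; first by rewrite ltr_wpDl // mulr_ge0 // ltW.
- have -> : (- c * N + 1)%:MP - c%:MP * p = (- c)%:MP * (N%:MP + p) + 1%:MP by ring.
  by apply: (qmD qmQ); [apply: (qmZ qmQ)|apply: (qmC qmQ)].
- have -> : (- c * N + 1)%:MP + c%:MP * p = (- c)%:MP * (N%:MP - p) + 1%:MP by ring.
  by apply: (qmD qmQ); [apply: (qmZ qmQ)|apply: (qmC qmQ)].
Qed.

Lemma qm_bounded_sqr_closed p : qm_bounded Q p -> qm_bounded Q (p ^+ 2).
Proof.
move=> [N [N0 Nm Np]]; exists (N ^+ 2); split; first exact: exprn_gt0.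
- exact: qm_bounded_sqr.
- apply: (qmD qmQ); first exact/(qmC qmQ)/sqr_ge0.
  exact/(qm_sos qmQ)/sos_sqr.
Qed.

Lemma mpolyC_quarter p : (4^-1)%:MP * (4 * p) = p.
Proof.
have e4 : (4^-1)%:MP * 4 = 1 :> {mpoly R[n]}.
  by rewrite -[4]/(4%:R) -(rmorph_nat (@mpolyC n R)) -mpolyCM mulVf ?mpolyC1 ?pnatr_eq0.
by rewrite mulrA e4 mul1r.
Qed.

(** Reduces closure under products to closure under sums, scalar multiples and squares; differences
    are written with [(-1)%:MP] for that purpose. *)
Lemma mul_polarization p q :
  p * q = (4^-1)%:MP * ((p + q) ^+ 2 + (-1)%:MP * (p + (-1)%:MP * q) ^+ 2).
Proof.
by rewrite -[LHS]mpolyC_quarter; congr (_ * _); ring.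
Qed.

Lemma qm_boundedM p q : qm_bounded Q p -> qm_bounded Q q -> qm_bounded Q (p * q).
Proof.
move=> bp bq; rewrite mul_polarization; apply/qm_boundedZ/qm_boundedD.
  exact/qm_bounded_sqr_closed/qm_boundedD.
exact/qm_boundedZ/qm_bounded_sqr_closed/qm_boundedD/qm_boundedZ.
Qed.

(** The bounded polynomials form a subalgebra, so it suffices to bound its generators. *)
Lemma qm_archimedean : (forall i, qm_bounded Q 'X_i) -> archimedean Q.
Proof.
move=> bX p; suff [N []] : qm_bounded Q p by exists N.
elim/mpoly_ring_ind: p => [c|i|p q|p q].
- exact: qm_boundedC.
- exact: bX.
- exact: qm_boundedD.
- exact: qm_boundedM.
Qed.

End Bounded.

(* A maximal module gives a point [v] such that [p - p.@[v]] is always infinitesimal. *)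
Definition infinitesimal (P : set {mpoly R[n]}) : set {mpoly R[n]} :=
  [set p | forall c : R, 0 < c -> P (c%:MP - p) /\ P (c%:MP + p)].

Section Infinitesimal.

Variable P : set {mpoly R[n]}.
Hypothesis qmP : quadratic_module P.

Lemma infinitesimal0 : infinitesimal P 0.
Proof. by move=> c c0; rewrite subr0 addr0; split; apply: (qmC qmP); rewrite ltW. Qed.

Lemma infinitesimalD p q :
  infinitesimal P p -> infinitesimal P q -> infinitesimal P (p + q).
Proof.
move=> ip iq c c0; have c2 : 0 < c / 2 by rewrite divr_gt0.
have [? ?] := ip _ c2; have [? ?] := iq _ c2.
have ec : c%:MP = (c / 2)%:MP + (c / 2)%:MP :> {mpoly R[n]}.
  by rewrite -mpolyCD; congr (_%:MP); lra.
split.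
- have -> : c%:MP - (p + q) = ((c / 2)%:MP - p) + ((c / 2)%:MP - q) by rewrite ec; ring.
  exact: (qmD qmP).
- have -> : c%:MP + (p + q) = ((c / 2)%:MP + p) + ((c / 2)%:MP + q) by rewrite ec; ring.
  exact: (qmD qmP).
Qed.

Lemma infinitesimalZ (a : R) p : infinitesimal P p -> infinitesimal P (a%:MP * p).
Proof.
move=> ip; have [->|a0] := eqVneq a 0.
  by rewrite mpolyC0 mul0r; apply: infinitesimal0.
move=> c c0; have ca : 0 < c / `|a| by rewrite divr_gt0 // normr_gt0.
have [im iP] := ip _ ca.
have qZ r : P r -> P (`|a|%:MP * r) by apply: (qmZ qmP).
have ec : c%:MP = `|a|%:MP * (c / `|a|)%:MP :> {mpoly R[n]}.
  by rewrite -mpolyCM; congr (_%:MP); field; rewrite normr_eq0.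
have {im} im := qZ _ im; have {iP} iP := qZ _ iP.
rewrite ec; have [a1|a1] := leP 0 a.
  by move: im iP; rewrite ger0_norm // mulrBr mulrDr.
by move: im iP; rewrite ltr0_norm // mulrBr mulrDr mpolyCN !mulNr opprK.
Qed.

Lemma infinitesimal_sqr p : infinitesimal P p -> infinitesimal P (p ^+ 2).
Proof.
move=> ip c c0; have sc : 0 < Num.sqrt c by rewrite sqrtr_gt0.
have [im iP] := ip _ sc; rewrite -(sqr_sqrtr (ltW c0)); split.
  exact: (qm_bounded_sqr qmP).
apply: (qmD qmP); first exact/(qmC qmP)/sqr_ge0.
exact/(qm_sos qmP)/sos_sqr.
Qed.

Lemma infinitesimalM p q :
  infinitesimal P p -> infinitesimal P q -> infinitesimal P (p * q).
Proof.
move=> ip iq; rewrite mul_polarization; apply/infinitesimalZ/infinitesimalD.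
  exact/infinitesimal_sqr/infinitesimalD.
exact/infinitesimalZ/infinitesimal_sqr/infinitesimalD/infinitesimalZ.
Qed.

(** A product is expanded around the values at [v], so that only products of two infinitesimals and
    scalar multiples of one occur. *)
Lemma infinitesimal_eval v :
  (forall i, infinitesimal P ('X_i - (v i)%:MP)) ->
  forall p, infinitesimal P (p - p.@[v]%:MP).
Proof.
move=> iX p; elim/mpoly_ring_ind: p => [c|i|p q ip iq|p q ip iq].
- by rewrite mevalC subrr; apply: infinitesimal0.
- by rewrite mevalXU.
- have -> : p + q - (p + q).@[v]%:MP = (p - p.@[v]%:MP) + (q - q.@[v]%:MP).
    by rewrite mevalD; ring.
  exact: infinitesimalD.
- have -> : p * q - (p * q).@[v]%:MP = (p - p.@[v]%:MP) * (q - q.@[v]%:MP)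
     + (p.@[v]%:MP * (q - q.@[v]%:MP) + q.@[v]%:MP * (p - p.@[v]%:MP)).
    by rewrite mevalM; ring.
  apply: infinitesimalD; first exact: infinitesimalM.
  by apply: infinitesimalD; apply: infinitesimalZ.
Qed.

End Infinitesimal.

(** * Maximal quadratic modules and their points *)

Definition adjoin (Q : set {mpoly R[n]}) p : set {mpoly R[n]} :=
  [set q | exists q0 s, [/\ Q q0, sos s & q = q0 + s * p]].

Lemma adjoin_sub Q p q : Q q -> adjoin Q p q.
Proof. by move=> Qq; exists q, 0; split; [|exact: sos0|rewrite mul0r addr0]. Qed.

Lemma adjoin_mem Q p : quadratic_module Q -> adjoin Q p p.
Proof.
move=> qmQ; exists 0, 1; split; [exact: qm0|exact: sos1|].
by rewrite mul1r add0r.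
Qed.

Lemma adjoin_qm Q p : quadratic_module Q -> quadratic_module (adjoin Q p).
Proof.
move=> qmQ; split.
- by apply: adjoin_sub; case: qmQ.
- move=> _ _ [q [s [Qq ss ->]]] [q' [s' [Qq' ss' ->]]].
  exists (q + q'), (s + s'); split; [exact: qmD|exact: sosD|by ring].
- move=> a _ [q [s [Qq ss ->]]]; exists (a ^+ 2 * q), (a ^+ 2 * s); split.
  + by apply: qm_sosM => //; apply: sos_sqr.
  + by apply: sosM => //; apply: sos_sqr.
  + by ring.
Qed.

Lemma maximal_quadratic_module (Q : set {mpoly R[n]}) :
  quadratic_module Q -> ~ Q (-1) ->
  exists P : set {mpoly R[n]}, [/\ quadratic_module P, (Q `<=` P)%classic, ~ P (-1) &
    forall p, ~ P p -> adjoin P p (-1)].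
Proof.
move=> qmQ QN1.
pose good (P : set {mpoly R[n]}) :=
  [/\ quadratic_module P, (Q `<=` P)%classic & ~ P (-1)].
(* The empty set is admitted so that the empty chain has an upper bound. *)
pose Z : set (set {mpoly R[n]}) := [set P | (exists p, P p) -> good P]%classic.
have [F FZ Ftot|P [ZP maxP]] := @Zorn_bigcup _ Z.
  move=> [p0 [P0 FP0 Pp0]].
  have gF P p : F P -> P p -> good P by move=> FP Pp; apply: FZ => //; exists p.
  have [[P01 P0D P0M] QP0 _] := gF _ _ FP0 Pp0.
  split; [split| |].
  - by exists P0.
  - move=> p q [P1 FP1 Pp] [P2 FP2 Pq].
    have [s12|s21] := Ftot _ _ FP1 FP2.
    + exists P2 => //; have [qm2 _ _] := gF _ _ FP2 Pq.
      by apply: (qmD qm2) => //; apply: s12.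
    + exists P1 => //; have [qm1 _ _] := gF _ _ FP1 Pp.
      by apply: (qmD qm1) => //; apply: s21.
  - move=> p q [P1 FP1 Pq]; exists P1 => //.
    by have [[_ _ M] _ _] := gF _ _ FP1 Pq; apply: M.
  - by move=> q Qq; exists P0 => //; apply: QP0.
  - by move=> [P1 FP1 PN]; have [_ _] := gF _ _ FP1 PN; apply.
have gQ : good Q by split.
have Q1 : Q 1 by case: qmQ.
(* The maximal element is not the empty set, since [Q] would be strictly larger. *)
have [p Pp] : exists p, P p.
  apply: contrapT => nP; apply: (maxP Q); last by move=> _.
  split; last by move=> /(_ 1 Q1) P1; apply: nP; exists 1.
  by move=> q Pq; case: nP; exists q.
have [qmP QP PN1] : good P by apply: ZP; exists p.
exists P; split => // q Pq; apply: contrapT => aN1.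
apply: (maxP (adjoin P q)) => [|_].
  split=> [r Pr|/(_ q)]; first exact: adjoin_sub.
  by move=> H; apply: Pq; apply: H; apply: adjoin_mem.
split => //; first exact: adjoin_qm.
by move=> r Qr; apply: adjoin_sub; apply: QP.
Qed.

(** If neither sign belongs to [P], then [-1 = q1 + s1 p = q2 - s2 p]. Eliminating [p] puts [- s1]
    in [P]; since [s1] is in [P] too, so is [s1 p], and the first identity puts -1 in [P]. *)
Lemma maximal_total (P : set {mpoly R[n]}) :
  quadratic_module P -> ~ P (-1) -> (forall p, ~ P p -> adjoin P p (-1)) ->
  forall p, P p \/ P (- p).
Proof.
move=> qmP PN1 maxP p.
have [Pp|/maxP[q1 [s1 [Pq1 ss1 e1]]]] := pselect (P p); first by left.
have [Pp|/maxP[q2 [s2 [Pq2 ss2 e2]]]] := pselect (P (- p)); first by right.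
exfalso; apply: PN1.
(* The support of P is an ideal and contains s1. *)
have Ps1 : P (- s1).
  have -> : - s1 = s1 * q2 + (s2 * q1 + s2).
    have -> : s2 = - (q1 + s1 * p) * s2 by rewrite -e1 opprK mul1r.
    have -> : - s1 = s1 * (q2 + s2 * - p) by rewrite -e2 mulrN1.
    transitivity (s1 * q2 + (s2 * q1 + (- (q1 + s1 * p) * s2))); first by ring.
    by congr (_ + (_ + _)); rewrite -e1 opprK mul1r.
  apply: qmD => //; first exact: qm_sosM.
  by apply: qmD; [|exact: qm_sosM|exact: qm_sos].
have Ps1p : P (s1 * p).
  have -> : s1 * p = (4^-1)%:MP * ((p + 1) ^+ 2 * s1 + (p - 1) ^+ 2 * (- s1)).
    by rewrite -[LHS]mpolyC_quarter; congr (_ * _); ring.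
  apply: qmZ => //; apply: qmD => //; last by apply: qm_sosM => //; apply: sos_sqr.
  by apply: qm_sosM; [|exact: sos_sqr|exact: qm_sos].
by rewrite e1; apply: qmD.
Qed.

(** The supremum of the [r] with [p - r] in [P] is the value of [p] up to an infinitesimal; the
    point collects the values of the variables. *)
Lemma total_point (P : set {mpoly R[n]}) :
  quadratic_module P -> ~ P (-1) -> archimedean P ->
  (forall p, P p \/ P (- p)) -> exists v, positivity_set P v.
Proof.
move=> qmP PN1 archP totP.
have PNC (c : R) : c < 0 -> ~ P c%:MP.
  move=> c0 Pc; apply: PN1; apply: (@qmZ_inv _ qmP (- c)); first by rewrite oppr_gt0.
  by rewrite mulrN1 -mpolyCN opprK.
have val p : exists a : R, infinitesimal P (p - a%:MP).
  pose L : set R := [set r | P (p - r%:MP)]%classic.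
  have [N PN] := archP p; have [M PM] := archP (- p).
  have L0 : (L !=set0)%classic.
    by exists (- M); rewrite /L /= mpolyCN opprK addrC; move: PM; rewrite opprK.
  have LN : ubound L N.
    move=> r Lr; rewrite leNgt; apply/negP => Nr; apply: (@PNC (N - r)); first lra.
    have -> : (N - r)%:MP = (N%:MP - p) + (p - r%:MP) :> {mpoly R[n]} by ring.
    exact: qmD.
  have supL : has_sup L by split => //; exists N.
  exists (sup L) => c c0; split.
  - have : ~ L (sup L + c).
      by move=> /(ub_le_sup (proj2 supL)); rewrite leNgt ltrDl c0.
    rewrite /L /= => nP; have [//|] := totP (p - (sup L + c)%:MP).
    by congr (P _); ring.
  - have [r Lr ltr] := sup_adherent c0 supL.
    have -> : c%:MP + (p - (sup L)%:MP) = (p - r%:MP) + (r - (sup L - c))%:MP by ring.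
    by apply: qmD => //; apply: qmC => //; lra.
have /choice [v Xv] i := val 'X_i.
exists v => q Pq; rewrite leNgt; apply/negP => q0.
have c0 : 0 < - q.@[v] / 2 by lra.
have [+ _] := infinitesimal_eval qmP Xv q c0.
(* Half of the negative value [q.@[v]] is the sum of [q] and another element of [P], which is
   impossible for a negative constant. *)
move=> /(qmD qmP Pq) Pc; apply: (@PNC (q.@[v] / 2)); first lra.
have -> : (q.@[v] / 2)%:MP = (- q.@[v] / 2 + q.@[v])%:MP :> {mpoly R[n]}.
  by congr (_%:MP); lra.
rewrite [X in P X](_ : _ = q + ((- q.@[v] / 2)%:MP - (q - q.@[v]%:MP))) //.
by ring.
Qed.

(** Without such an identity, -1 stays outside the module generated by [Q] and [- h]. A maximal
    extension of that module has a point, which lies in the positivity set of [Q] and satisfies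
    [h <= 0]. *)
Lemma positivstellensatz (Q : set {mpoly R[n]}) h :
  quadratic_module Q -> archimedean Q ->
  (forall v, positivity_set Q v -> 0 < h.@[v]) ->
  exists2 s, sos s & Q (s * h - 1).
Proof.
move=> qmQ archQ hpos; apply: contrapT => nex.
have qmA := adjoin_qm (- h) qmQ.
have AN1 : ~ adjoin Q (- h) (-1).
  move=> [q [s [Qq ss e]]]; apply: nex; exists s => //.
  suff -> : s * h - 1 = q by [].
  by rewrite e; ring.
have [P [qmP AP PN1 maxP]] := maximal_quadratic_module qmA AN1.
have QP : (Q `<=` P)%classic by move=> q Qq; apply/AP/adjoin_sub.
have archP : archimedean P by move=> p; have [N QN] := archQ p; exists N; apply: QP.
have [v Pv] := total_point qmP PN1 archP (maximal_total qmP PN1 maxP).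
have := hpos v (fun q Qq => Pv q (QP q Qq)).
have := Pv _ (AP _ (adjoin_mem _ qmQ)).
by rewrite mevalN oppr_ge0 => /le_lt_trans h0 /h0; rewrite ltxx.
Qed.

(** * Putinar's theorem and substitutes for compactness *)

Section Archimedean.

Variable Q : set {mpoly R[n]}.
Hypotheses (qmQ : quadratic_module Q) (archQ : archimedean Q).

Lemma archimedean_gt p : exists N : R, 0 < N /\ Q (N%:MP - p).
Proof.
have [N QN] := archQ p; exists (`|N| + 1); split; first by rewrite ltr_wpDl.
have -> : (`|N| + 1)%:MP - p = (N%:MP - p) + (`|N| + 1 - N)%:MP by ring.
by apply: qmD => //; apply: qmC => //; have := ler_norm N; lra.
Qed.

Lemma archimedean_ub p :
  exists2 N : R, 0 < N & forall v, positivity_set Q v -> p.@[v] <= N.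
Proof.
have [N [N0 QN]] := archimedean_gt p; exists N => // v /(_ _ QN).
by rewrite mevalB mevalC subr_ge0.
Qed.

(** Takes the place of a minimum over a compact set: [s h >= 1] and [s <= N] give [h >= 1 / N]. *)
Lemma archimedean_lb h : (forall v, positivity_set Q v -> 0 < h.@[v]) ->
  exists2 c : R, 0 < c & forall v, positivity_set Q v -> c <= h.@[v].
Proof.
move=> hpos; have [s ss Qs] := positivstellensatz qmQ archQ hpos.
have [N N0 sN] := archimedean_ub s; exists N^-1; first by rewrite invr_gt0.
move=> v Qv; have := Qv _ Qs; rewrite mevalB mevalM meval1 subr_ge0 => sh.
rewrite -(ler_pM2l N0) divff ?gt_eqF //; apply: (le_trans sh).
by rewrite ler_pM2r ?sN ?hpos.
Qed.

(** Some [h + K] is in [Q] by the Archimedean property; the constant is then removed in finitely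
    many steps of the fixed size [k^-1]. *)
Lemma putinar h : (forall v, positivity_set Q v -> 0 < h.@[v]) -> Q h.
Proof.
move=> hpos; have [s ss Qs] := positivstellensatz qmQ archQ hpos.
have [N [N0 QN]] := archimedean_gt s; have [M [M0 QM]] := archimedean_gt (s ^+ 2 * h).
have [K [K0 QK]] := archimedean_gt (- h).
(* [N] bounds [s] and [M] bounds [s ^+ 2 * h]; the sum serves for both [Qk2] and [Qk]. *)
pose k := N + M.
have k0 : 0 < k by rewrite addr_gt0.
have Qk2 : Q ((2 * k)%:MP - s).
  have -> : (2 * k)%:MP - s = (N%:MP - s) + (N + 2 * M)%:MP by rewrite /k; ring.
  by apply: qmD => //; apply: qmC => //; lra.
have Qk : Q (k%:MP - s ^+ 2 * h).
  have -> : k%:MP - s ^+ 2 * h = (M%:MP - s ^+ 2 * h) + N%:MP by rewrite /k; ring.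
  by apply: qmD => //; apply: qmC => //; lra.
have step (r : R) : 0 <= r -> Q (h + r%:MP) -> Q (h + (r - k^-1)%:MP).
  move=> r0 Qhr; apply: (@qmZ_inv _ qmQ (k ^+ 2)); first exact: exprn_gt0.
  have ek : (k ^+ 2)%:MP * (k^-1)%:MP = k%:MP :> {mpoly R[n]}.
    by rewrite -mpolyCM; congr (_%:MP); field; rewrite gt_eqF.
  (* All terms of the right-hand side that contain [s] cancel, and [k ^+ 2 * (h + r) - k]
     remains. *)
  have -> : (k ^+ 2)%:MP * (h + (r - k^-1)%:MP) =
      (k%:MP - s) ^+ 2 * (h + r%:MP) + (2 * k)%:MP * (s * h - 1)
      + r%:MP * (s * ((2 * k)%:MP - s)) + (k%:MP - s ^+ 2 * h).
    by rewrite mpolyCB mulrDr mulrBr ek; ring.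
  apply: qmD => //; apply: qmD => //; last by apply: qmZ => //; apply: qm_sosM.
  apply: qmD => //; last by apply: qmZ => //; lra.
  by apply: qm_sosM => //; apply: sos_sqr.
have down (j : nat) : Q (h + (j%:R / k)%:MP) -> Q h.
  elim: j => [|j IH]; first by rewrite mul0r mpolyC0 addr0.
  move=> /step H; apply: IH.
  have -> : j%:R / k = j.+1%:R / k - k^-1 by rewrite -natr1 mulrDl mul1r addrK.
  by apply: H; rewrite divr_ge0 // ltW.
have [j Kj] : exists j : nat, K * k <= j%:R.
  by exists (Num.bound (K * k)); apply/ltW/archi_boundP; rewrite mulr_ge0 // ltW.
apply: (down j).
have -> : h + (j%:R / k)%:MP = (K%:MP - - h) + (j%:R / k - K)%:MP by ring.
by apply: qmD => //; apply: qmC => //; rewrite subr_ge0 ler_pdivlMr.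
Qed.

(** The zeros of [f] in the positivity set of [Q] form the positivity set of [adjoin Q (- f)], which
    yields an identity [s g - 1 = q - t f]. Where [g <= 0] it forces [t f >= 1], so [f] is bounded
    away from 0 there. *)
Lemma archimedean_penalty f g :
  (forall v, positivity_set Q v -> 0 <= f.@[v]) ->
  (forall v, positivity_set Q v -> f.@[v] = 0 -> 0 < g.@[v]) ->
  exists2 K : R, 0 < K &
    forall v, positivity_set Q v -> 0 < (g + K%:MP * f).@[v].
Proof.
move=> f0 g0.
have qmA := adjoin_qm (- f) qmQ.
have archA : archimedean (adjoin Q (- f)).
  by move=> p; have [N QN] := archQ p; exists N; apply: adjoin_sub.
have [v Av|s ss [q [t [Qq st e]]]] := positivstellensatz (h := g) qmA archA.
  have Qv : positivity_set Q v by move=> q Qq; apply/Av/adjoin_sub.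
  apply: g0 => //; apply/le_anti; rewrite f0 // andbT -oppr_ge0 -mevalN.
  exact/Av/adjoin_mem.
have [T T0 tT] := archimedean_ub t; have [G G0 gG] := archimedean_ub (- g).
(* Where [T f >= 1], the two terms contribute at least [G] and at least 1, and [- g] is at most
   [G]. *)
exists (T * G + T); first by rewrite addr_gt0 // mulr_gt0.
move=> v Qv; rewrite mevalD mevalM mevalC.
have [gv0|gv0] := ltP 0 g.@[v].
  by apply: ltr_wpDr => //; rewrite mulr_ge0 ?f0 // addr_ge0 ?mulr_ge0 // ltW.
have := congr1 (meval v) e.
rewrite mevalB mevalD !mevalM meval1 mevalN => ev.
have q0 := Qv _ Qq; have s0 := sos_ge0 v ss; have t0 := sos_ge0 v st.
have tf : 1 <= t.@[v] * f.@[v].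
  have : s.@[v] * g.@[v] <= 0 by rewrite mulr_ge0_le0.
  lra.
have tf2 : t.@[v] * f.@[v] <= T * f.@[v] by rewrite ler_wpM2r ?f0 ?tT.
have Tf : 1 <= T * f.@[v] by lra.
have := gG v Qv; rewrite mevalN => gv.
have : G * 1 <= G * (T * f.@[v]) by rewrite ler_pM2l.
nra.
Qed.

End Archimedean.

(** * Small powers and geometric sums *)

Lemma expr_small (x c : R) : 0 <= x -> x < 1 -> 0 < c -> exists k, x ^+ k < c.
Proof.
move=> x0 x1 c0.
have bern k : x ^+ k * (1 + k%:R * (1 - x)) <= 1.
  elim: k => [|k IH]; first by rewrite expr0 mul0r addr0 mul1r.
  have xk : x ^+ k <= 1 by rewrite exprn_ile1 // ltW.
  have xk0 : 0 <= x ^+ k by rewrite exprn_ge0.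
  rewrite exprS -natr1.
  have : x * (x ^+ k * (1 + k%:R * (1 - x))) <= x * 1 by rewrite ler_wpM2l.
  have : x * x ^+ k * (1 - x) <= 1 * (1 - x).
    by rewrite ler_wpM2r ?subr_ge0 1?ltW // -exprS exprn_ilt1.
  lra.
pose k := Num.bound (c * (1 - x))^-1.
exists k; have cx : 0 < c * (1 - x) by rewrite mulr_gt0 ?subr_gt0.
have kP : (c * (1 - x))^-1 < k%:R.
  by apply: archi_boundP; rewrite invr_ge0 ltW.
rewrite ltNge; apply/negP => cxk.
have : 1 < k%:R * (c * (1 - x)) by rewrite -ltr_pdivrMr // div1r.
have k0 : 0 <= k%:R * (1 - x) by rewrite mulr_ge0 ?ler0n // subr_ge0 ltW.
have := bern k.
have : c * (1 + k%:R * (1 - x)) <= x ^+ k * (1 + k%:R * (1 - x)).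
  by rewrite ler_wpM2r // addr_ge0.
lra.
Qed.

Definition geometric_sum (m : nat) p : {mpoly R[n]} := \sum_(j < m.*2.+1) p ^+ j.

Lemma geometric_sumE m p : (1 - p) * geometric_sum m p = 1 - p ^+ m.*2.+1.
Proof. by rewrite -opprB mulNr -subrX1 opprB. Qed.

(** The geometric sum minus [1/2] and half of [p ^+ m.*2] equals half the sum of the squares of
    [p ^+ j + p ^+ j.+1] for [j < m]; the induction runs on this stronger form. *)
Lemma geometric_sum_sos m p : sos (geometric_sum m p - (2^-1)%:MP).
Proof.
have e2 q : (2^-1)%:MP * (2 * q) = q.
  by rewrite mulrA -(rmorph_nat (@mpolyC n R)) -mpolyCM mulVf ?mpolyC1 ?mul1r ?pnatr_eq0.
have h0 : 0 <= 2^-1 :> R by rewrite invr_ge0.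
suff H : sos (geometric_sum m p - (2^-1)%:MP - (2^-1)%:MP * (p ^+ m) ^+ 2).
  rewrite -[X in sos X](subrK ((2^-1)%:MP * (p ^+ m) ^+ 2)).
  by apply: sosD => //; apply: sosM; [exact: sosC|exact: sos_sqr].
elim: m => [|m IH].
  rewrite /geometric_sum big_ord1 expr0 expr1n mulr1.
  by rewrite -(e2 1) (_ : _ - _ = 0); [exact: sos0|ring].
have -> : geometric_sum m.+1 p - (2^-1)%:MP - (2^-1)%:MP * (p ^+ m.+1) ^+ 2 =
   (geometric_sum m p - (2^-1)%:MP - (2^-1)%:MP * (p ^+ m) ^+ 2)
   + (2^-1)%:MP * (p ^+ m + p ^+ m.+1) ^+ 2.
  rewrite /geometric_sum doubleS big_ord_recr big_ord_recr /=.
  have -> : p ^+ m.*2.+2 = (p ^+ m.+1) ^+ 2 by rewrite -exprM muln2 doubleS.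
  have -> : p ^+ m.*2.+1 = p ^+ m * p ^+ m.+1 by rewrite -exprD addnS addnn.
  set a := p ^+ m; set b := p ^+ m.+1.
  have -> : (2^-1)%:MP * (a + b) ^+ 2 =
    (2^-1)%:MP * a ^+ 2 + (2^-1)%:MP * (2 * (a * b)) + (2^-1)%:MP * b ^+ 2 by ring.
  by rewrite e2 -[X in _ + X - _ - _](e2 (b ^+ 2)); ring.
by apply: sosD => //; apply: sosM; [exact: sosC|exact: sos_sqr].
Qed.

Lemma geometric_sum_sos0 m p : sos (geometric_sum m p).
Proof.
rewrite -(subrK (2^-1)%:MP (geometric_sum m p)).
by apply: sosD; [exact: geometric_sum_sos|apply: sosC; rewrite invr_ge0].
Qed.

Lemma geometric_sum_ge m p v : 2^-1 <= (geometric_sum m p).@[v].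
Proof.
by have := sos_ge0 v (geometric_sum_sos m p); rewrite mevalB mevalC subr_ge0.
Qed.

(** * From local to global certificates *)

Definition sqdist v : {mpoly R[n]} := \sum_(j < n) ('X_j - (v j)%:MP) ^+ 2.

Lemma sqdist_sos v : sos (sqdist v).
Proof. by apply: sos_sum => j _; apply: sos_sqr. Qed.

Lemma sqdistE v w : (sqdist v).@[w] = \sum_(j < n) (w j - v j) ^+ 2.
Proof.
by rewrite rmorph_sum; apply: eq_bigr => j _; rewrite rmorphXn /= mevalB mevalXU mevalC.
Qed.

Lemma sqdist_eq0 v w : ((sqdist v).@[w] == 0) = [forall j, w j == v j].
Proof.
rewrite sqdistE psumr_eq0; last by move=> j _; apply: sqr_ge0.
apply/allP/forallP => H j; last by rewrite sqrf_eq0 subr_eq0 H.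
by have := H j (mem_index_enum _); rewrite sqrf_eq0 subr_eq0.
Qed.

(** [p - p.@[v]] lies in the ideal of the point [v]. Domination by [sqdist v] holds for the
    generators of that ideal, passes to multiples, and passes to sums by
    [(q + q')^2 <= 2 q^2 + 2 q'^2]. *)
Lemma sqr_le_sqdist v p :
  exists2 H, sos H & sos (sqdist v * H - (p - p.@[v]%:MP) ^+ 2).
Proof.
have sos2 : @sos R n 2 by exact: sosD sos1 sos1.
pose ok q := exists2 H, sos H & sos (sqdist v * H - q ^+ 2).
have okD q q' : ok q -> ok q' -> ok (q + q').
  move=> [H sH qH] [H' sH' qH']; exists (2 * (H + H')).
    exact/sosM/sosD.
  have -> : sqdist v * (2 * (H + H')) - (q + q') ^+ 2 =
    2 * (sqdist v * H - q ^+ 2) + 2 * (sqdist v * H' - q' ^+ 2) + (q - q') ^+ 2 by ring.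
  by apply: sosD (sos_sqr _); apply: sosD; apply: sosM.
have okM q q' : ok q -> ok (q' * q).
  move=> [H sH qH]; exists (q' ^+ 2 * H); first exact: sosM (sos_sqr _) _.
  have -> : sqdist v * (q' ^+ 2 * H) - (q' * q) ^+ 2 = q' ^+ 2 * (sqdist v * H - q ^+ 2).
    by ring.
  exact: sosM (sos_sqr _) _.
suff : ok (p - p.@[v]%:MP) by [].
elim/mpoly_ring_ind: p => [c|i|p q okp okq|p q okp okq].
- rewrite mevalC subrr; exists 0; first exact: sos0.
  by rewrite mulr0 expr0n subr0; exact: sos0.
- rewrite mevalXU; exists 1; first exact: sos1.
  rewrite mulr1 /sqdist (bigD1 i) //= addrAC subrr add0r.
  by apply: sos_sum => j _; apply: sos_sqr.
- have -> : p + q - (p + q).@[v]%:MP = (p - p.@[v]%:MP) + (q - q.@[v]%:MP).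
    by rewrite mevalD; ring.
  exact: okD.
- have -> : p * q - (p * q).@[v]%:MP = q * (p - p.@[v]%:MP) + p.@[v]%:MP * (q - q.@[v]%:MP).
    by rewrite mevalM; ring.
  by apply: okD; apply: okM.
Qed.

Section LocalGlobal.

Variables (Q : set {mpoly R[n]}) (I : finType) (a : I -> 'I_n -> R) (f : {mpoly R[n]}).
Hypotheses (qmQ : quadratic_module Q) (archQ : archimedean Q).
Hypothesis a_inj : forall i k, (forall j, a i j = a k j) -> i = k.
Hypothesis f_ge0 : forall v, positivity_set Q v -> 0 <= f.@[v].
Hypothesis f_zero : forall v, positivity_set Q v -> f.@[v] = 0 ->
  exists i, forall j, v j = a i j.

Let W := \prod_i sqdist (a i).
Let W' i := \prod_(k | k != i) sqdist (a k).

Let W_sos : sos W. Proof. by apply: sos_prod => i _; apply: sqdist_sos. Qed.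

Let WE i : W = sqdist (a i) * W' i. Proof. by rewrite /W (bigD1 i). Qed.

Let W'_sos i : sos (W' i). Proof. by apply: sos_prod => k _; apply: sqdist_sos. Qed.

Let sqdist_self i : (sqdist (a i)).@[a i] = 0.
Proof. by apply/eqP; rewrite sqdist_eq0; apply/forallP. Qed.

Let W'_gt0 i : 0 < (W' i).@[a i].
Proof.
rewrite rmorph_prod; apply: prodr_gt0 => k ki.
rewrite lt_neqAle sos_ge0 ?andbT; last exact: sqdist_sos.
rewrite eq_sym sqdist_eq0; apply: contraNN ki => /forallP H.
by apply/eqP/a_inj => j; rewrite (eqP (H j)).
Qed.

Let W'_eq0 i k : i != k -> (W' k).@[a i] = 0.
Proof. by move=> ik; rewrite rmorph_prod /= (bigD1 i) //= sqdist_self mul0r. Qed.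

Let W_eq0 i : W.@[a i] = 0.
Proof. by rewrite (WE i) mevalM sqdist_self mul0r. Qed.

Let W_zero v : W.@[v] = 0 -> exists i, forall j, v j = a i j.
Proof.
rewrite rmorph_prod => /eqP; rewrite prodf_seq_eq0 => /hasP[i _ /=].
by rewrite sqdist_eq0 => /forallP H; exists i => j; apply/eqP.
Qed.

Let sum_delta i (F : I -> {mpoly R[n]}) (G : I -> {mpoly R[n]}) :
  (\sum_k F k * W' k * G k).@[a i] = (F i).@[a i] * (W' i).@[a i] * (G i).@[a i].
Proof.
rewrite rmorph_sum /= (bigD1 i) //= big1 ?addr0 ?mevalM // => k ki.
by rewrite !mevalM W'_eq0 1?eq_sym // mulr0 mul0r.
Qed.

(* The multiplier is [\sum_i c_i W'_i^2 + K W]; the penalty [K f] makes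
   [\sum_i c_i W'_i k_i + K f] positive, since its first summand is positive at
   the zeros of [f]. *)
Lemma local_multiplier :
  (forall i, exists2 k, 0 < k.@[a i] & Q (f - sqdist (a i) * k)) ->
  exists u h, [/\ forall i, u.@[a i] = 1,
    forall v, positivity_set Q v -> 0 < u.@[v],
    forall v, positivity_set Q v -> 0 < h.@[v] & Q (u * f - W * h)].
Proof.
move=> loc; have /choice[k kP] i : exists k, 0 < k.@[a i] /\ Q (f - sqdist (a i) * k).
  by have [k] := loc i; exists k.
pose w i : R := (W' i).@[a i].
(* This factor gives [u] the value 1 at [a i], where [W] and all other [W' k] vanish. *)
pose c i : {mpoly R[n]} := (w i ^- 2)%:MP.
pose g := \sum_i c i * W' i * k i.
have g_gt0 v : positivity_set Q v -> f.@[v] = 0 -> 0 < g.@[v].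
  move=> Qv /(f_zero Qv)[i vi]; rewrite (meval_eq _ vi) sum_delta mevalC.
  rewrite mulr_gt0 //; last by case: (kP i).
  by rewrite mulr_gt0 ?invr_gt0 ?exprn_gt0 // W'_gt0.
have [K K0 hK] := archimedean_penalty qmQ archQ f_ge0 g_gt0.
pose u := \sum_i c i * W' i * W' i + K%:MP * W.
have u1 i : u.@[a i] = 1.
  rewrite mevalD sum_delta mevalM W_eq0 mulr0 addr0 mevalC -/(w i) -mulrA -expr2.
  by rewrite mulVf // expf_neq0 // gt_eqF // W'_gt0.
have sos_u0 : sos (\sum_i c i * W' i * W' i).
  apply: sos_sum => i _; apply: sosM => //; apply: sosM => //; apply: sosC.
  by rewrite invr_ge0 sqr_ge0.
exists u, (g + K%:MP * f); split => // [v Qv|].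
  have [/W_zero[i vi]|W0] := eqVneq W.@[v] 0.
    by rewrite (meval_eq _ vi) u1 ltr01.
  rewrite mevalD mevalM mevalC ltr_wpDl ?sos_ge0 // mulr_gt0 //.
  by rewrite lt_neqAle eq_sym W0 sos_ge0.
(* The penalty terms [K W f] cancel, and [WE] splits the rest into the local certificates, weighted
   by sums of squares. *)
have -> : u * f - W * (g + K%:MP * f) =
    \sum_i c i * W' i * W' i * (f - sqdist (a i) * k i).
  have -> : u * f - W * (g + K%:MP * f) = (\sum_i c i * W' i * W' i) * f - W * g.
    by rewrite /u; ring.
  rewrite mulr_suml mulr_sumr -sumrB; apply: eq_bigr => i _.
  by rewrite {1}(WE i); ring.
apply: qm_sum => // i _; apply: qm_sosM => //; last by case: (kP i).
apply: sosM => //; apply: sosM => //; apply: sosC.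
by rewrite invr_ge0 sqr_ge0.
Qed.

(** Multiplication by the sum of squares [q] keeps the certificate and turns [u] into
    [(1 - p^(2m+1)) / t], where [p = 1 - u / c] lies strictly between 0 and 1 on the positivity set.
    As [t] is the value of the numerator at each [a i] and exceeds [1/2], the new multiplier is 1
    there and stays below 2. *)
Lemma local_multiplier_lt2 :
  (forall i, exists2 k, 0 < k.@[a i] & Q (f - sqdist (a i) * k)) ->
  exists u h, [/\ forall i, u.@[a i] = 1,
    forall v, positivity_set Q v -> 0 < u.@[v] < 2,
    forall v, positivity_set Q v -> 0 < h.@[v] & Q (u * f - W * h)].
Proof.
move=> /local_multiplier[u [h [u1 u0 h0 Quh]]].
have [N N0 uN] := archimedean_ub qmQ archQ u.
pose c := N + 1; have c1 : 1 < c by rewrite ltrDr.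
have c0 : 0 < c by apply: lt_trans c1.
pose p := 1 - c^-1%:MP * u.
have pE v : p.@[v] = 1 - c^-1 * u.@[v] by rewrite mevalB meval1 mevalM mevalC.
pose x := 1 - c^-1.
have x0 : 0 <= x by rewrite subr_ge0 invf_le1 // ltW.
have x1 : x < 1 by rewrite ltrBlDr ltrDl invr_gt0.
have [m xm] : exists m : nat, x ^+ m < 2^-1 by apply: expr_small; rewrite ?invr_gt0.
pose t := 1 - x ^+ m.*2.+1.
have xt : x ^+ m.*2.+1 < 2^-1.
  apply: le_lt_trans xm; apply: ler_wiXn2l => //; first exact: ltW.
  by rewrite -addnn -addSn leq_addl.
have t0 : 2^-1 < t by rewrite /t; lra.
have tp : 0 < t by apply: lt_trans t0; rewrite invr_gt0.
pose q := (t^-1 * c^-1)%:MP * geometric_sum m p.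
have q_sos : sos q.
  apply: sosM; last exact: geometric_sum_sos0.
  by apply: sosC; rewrite mulr_ge0 // invr_ge0 ltW.
have q_gt0 v : 0 < q.@[v].
  rewrite mevalM mevalC mulr_gt0 //; first by rewrite mulr_gt0 // invr_gt0.
  by apply: lt_le_trans (geometric_sum_ge _ _ _); rewrite invr_gt0.
have qu : q * u = t^-1%:MP * (1 - p ^+ m.*2.+1).
  rewrite -geometric_sumE /q mpolyCM.
  have -> : 1 - p = c^-1%:MP * u by rewrite /p; ring.
  by ring.
exists (q * u), (q * h); split.
- move=> i; rewrite qu mevalM mevalB meval1 mevalC rmorphXn /= pE u1.
  by rewrite mulr1 -/x -/t mulVf // gt_eqF.
- move=> v Qv; rewrite {1}mevalM mulr_gt0 ?u0 //= qu.
  rewrite mevalM mevalB meval1 mevalC rmorphXn /=.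
  have p0 : 0 < p.@[v].
    rewrite pE subr_gt0 mulrC ltr_pdivrMr // mul1r.
    by apply: le_lt_trans (uN _ Qv) _; rewrite ltrDl.
  have : 0 < p.@[v] ^+ m.*2.+1 by rewrite exprn_gt0.
  move: (p.@[v] ^+ _) => y y0.
  have : t^-1 * t = 1 by rewrite mulVf // gt_eqF.
  have : 0 < t^-1 by rewrite invr_gt0.
  by move: (t^-1) t0 => s; nra.
- by move=> v Qv; rewrite mevalM mulr_gt0 ?h0.
- have -> : q * u * f - W * (q * h) = q * (u * f - W * h) by ring.
  exact: qm_sosM.
Qed.

(** As [p] vanishes at every [a i], its square is dominated by each [sqdist (a i)] times a sum of
    squares; the product of these bounds has [W] on one side. *)
Let expr_le_W p : (forall i, p.@[a i] = 0) ->
  exists2 H, sos H & sos (W * H - p ^+ (#|I|.*2)).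
Proof.
move=> p0; have /choice[H HP] i : exists H, sos H /\ sos (sqdist (a i) * H - p ^+ 2).
  have [H sH] := sqr_le_sqdist (a i) p.
  by rewrite p0 mpolyC0 subr0; exists H.
exists (\prod_i H i); first by apply: sos_prod => i _; case: (HP i).
have -> : p ^+ (#|I|.*2) = \prod_(i : I) p ^+ 2.
  by rewrite prodr_const -exprM mul2n.
rewrite -big_split /=.
(* Inequalities are multiplied here, so [le] records that both sides are sums of squares. *)
pose le (x y : {mpoly R[n]}) := [/\ sos x, sos y & sos (x - y)].
suff [_ _ //] : le (\prod_i (sqdist (a i) * H i)) (\prod_(i : I) p ^+ 2).
apply: (big_ind2 le) => [|x y x' y' [sx sy sxy] [sx' sy' sxy']|i _].
- by split; [exact: sos1|exact: sos1|rewrite subrr; exact: sos0].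
- split; [exact: sosM|exact: sosM|].
  have -> : x * x' - y * y' = (x - y) * x' + y * (x' - y') by ring.
  by apply: sosD; apply: sosM.
- have [sH sHp] := HP i; split => //; last exact: sos_sqr.
  exact: sosM (sqdist_sos _) sH.
Qed.

Theorem local_global :
  (forall i, exists2 k, 0 < k.@[a i] & Q (f - sqdist (a i) * k)) -> Q f.
Proof.
move=> /local_multiplier_lt2[u [h [u1 u2 h0 Quh]]].
pose p := 1 - u.
have p0 i : p.@[a i] = 0 by rewrite mevalB meval1 u1 subrr.
have [H sH HW] := expr_le_W p0.
(* [f p + B] is [x^2 + x + 1] at [x = f p], a sum of squares. Up to sums of squares, the term
   [p^(2m+1) f] of indefinite sign becomes [- p^(2m) B]. *)
pose B := 1 + (f * p) ^+ 2.
have sB : sos B by apply: sosD; [exact: sos1|exact: sos_sqr].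
have sfB : sos (f * p + B).
  have -> : f * p + B = (4^-1)%:MP * (4 * (f * p + B)) by rewrite mpolyC_quarter.
  have -> : 4 * (f * p + B) = (2 * (f * p) + 1) ^+ 2 + (1 + 1 + 1) by rewrite /B; ring.
  apply: sosM; first by apply: sosC; rewrite invr_ge0.
  by apply: sosD (sos_sqr _) _; do !apply: sosD; exact: sos1.
have [c c0 ch] := archimedean_lb qmQ archQ h0.
have [N N0 BN] := archimedean_ub qmQ archQ (B * H).
have p1 v : positivity_set Q v -> 0 < (1 - p ^+ 2).@[v].
  by move=> /u2/andP[]; rewrite mevalB rmorphXn /= mevalB meval1; nra.
have [d d0 dp] := archimedean_lb qmQ archQ p1.
(* The maximum matters when the positivity set is empty, since [d] may then exceed 1. *)
pose y := Num.max 0 (1 - d).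
have y0 : 0 <= y by rewrite le_max lexx.
have y1 : y < 1 by rewrite gt_max ltr01 ltrBlDr ltrDl.
have [L yL] : exists L, y ^+ L < c / 2 / N by apply: expr_small => //; rewrite !divr_gt0.
(* The part [#|I|] of the exponent pays for a factor [W]; the part [L] makes the remaining error
   smaller than [c / 2], a lower bound of [s h] on the positivity set. *)
pose m := (#|I| + L)%N; pose s := geometric_sum m p.
have fE : f = s * (u * f - W * h) + (p ^+ L.*2 * p ^+ (#|I|.*2)) * (f * p + B)
   + p ^+ L.*2 * B * (W * H - p ^+ (#|I|.*2))
   + W * (s * h - p ^+ L.*2 * (B * H)).
  have us : u * s = 1 - p ^+ L.*2 * p ^+ (#|I|.*2) * p.
    have -> : u = 1 - p by rewrite /p; ring.
    by rewrite geometric_sumE -exprD -exprSr /m doubleD addnC.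
  have -> : s * (u * f - W * h) = (u * s) * f - W * (s * h) by ring.
  by rewrite us; ring.
have even_sos k : sos (p ^+ k.*2) by rewrite -addnn exprD -expr2; exact: sos_sqr.
rewrite fE; apply: qmD => //; first apply: qmD => //; first apply: qmD => //.
- by apply: qm_sosM => //; exact: geometric_sum_sos0.
- by apply: qm_sos => //; apply: sosM => //; apply: sosM.
- by apply: qm_sos => //; apply: sosM => //; apply: sosM.
apply: qm_sosM => //; apply: (putinar qmQ archQ) => v Qv.
rewrite mevalB !mevalM -mevalM rmorphXn /=.
have hv := ch _ Qv; have sv := geometric_sum_ge m p v.
have : 2^-1 * c <= s.@[v] * h.@[v].
  by apply: ler_pM => //; exact: ltW.
have pL : p.@[v] ^+ L.*2 <= y ^+ L.
  rewrite -mul2n exprM; apply: lerXn2r; rewrite ?nnegrE ?sqr_ge0 //.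
  have := dp _ Qv; rewrite mevalB meval1 rmorphXn /= /y le_max => H1.
  by apply/orP; right; lra.
have BH0 : 0 <= (B * H).@[v] by apply/sos_ge0/sosM.
have : p.@[v] ^+ L.*2 * (B * H).@[v] <= y ^+ L * N.
  by apply: ler_pM => //; [rewrite -mul2n exprM exprn_ge0 // sqr_ge0|exact: BN].
have : y ^+ L * N < c / 2 by rewrite -ltr_pdivlMr.
rewrite mevalM; lra.
Qed.

End LocalGlobal.

End PolynomialCones.

(** * The simplex and maximum stable sets *)

Section Simplex.

Variables (R : realType) (n : nat).

(** No degrees are bounded here; an order of truncation is read off from the finished
    certificate. *)
Definition simplex_module : set {mpoly R[n]} :=
  [set p | exists s0 s u, [/\ sos s0, forall j, sos (s j) &
     p = s0 + \sum_(j < n) s j * 'X_j + u * (1 - \sum_(i < n) 'X_i)]].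

Lemma simplex_module_qm : quadratic_module simplex_module.
Proof.
split.
- exists 1, (fun=> 0), 0; split; [exact: sos1|by move=> j; exact: sos0|].
  by rewrite mul0r addr0 big1 ?addr0 // => j _; rewrite mul0r.
- move=> _ _ [s0 [s [u [ss0 ss ->]]]] [t0 [t [w [st0 st ->]]]].
  exists (s0 + t0), (fun j => s j + t j), (u + w); split.
  + exact: sosD.
  + by move=> j; apply: sosD.
  + have -> : \sum_(j < n) (s j + t j) * 'X_j =
        \sum_(j < n) s j * 'X_j + \sum_(j < n) t j * 'X_j.
      by rewrite -big_split; apply: eq_bigr => j _; rewrite mulrDl.
    by ring.
- move=> p _ [s0 [s [u [ss0 ss ->]]]].
  exists (p ^+ 2 * s0), (fun j => p ^+ 2 * s j), (p ^+ 2 * u); split.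
  + exact: sosM (sos_sqr _) _.
  + by move=> j; apply: sosM (sos_sqr _) _.
  + have -> : \sum_(j < n) p ^+ 2 * s j * 'X_j = p ^+ 2 * \sum_(j < n) s j * 'X_j.
      by rewrite mulr_sumr; apply: eq_bigr => j _; rewrite mulrA.
    by ring.
Qed.

Lemma simplex_module_X i : simplex_module 'X_i.
Proof.
exists 0, (fun j => if j == i then 1 else 0), 0; split; first exact: sos0.
  by move=> j; case: ifP => _; [exact: sos1|exact: sos0].
rewrite mul0r addr0 add0r (bigD1 i) //= eqxx mul1r big1 ?addr0 // => j /negbTE ->.
by rewrite mul0r.
Qed.

Lemma simplex_module_ideal u : simplex_module (u * (1 - \sum_(i < n) 'X_i)).
Proof.
exists 0, (fun=> 0), u; split; [exact: sos0|by move=> j; exact: sos0|].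
have -> : \sum_(j < n) 0 * 'X_j = 0 :> {mpoly R[n]}.
  by apply: big1 => j _; rewrite mul0r.
by rewrite !add0r.
Qed.

Lemma simplex_module_archimedean : archimedean simplex_module.
Proof.
have qmQ := simplex_module_qm.
apply: qm_archimedean => // i; exists 1; split; first exact: ltr01.
- have -> : 1%:MP - 'X_i = \sum_(j < n | j != i) 'X_j + 1 * (1 - \sum_(j < n) 'X_j)
    :> {mpoly R[n]} by rewrite mpolyC1 [\sum_(j < n) 'X_j](bigD1 i) //=; ring.
  apply: (qmD qmQ); last exact: simplex_module_ideal.
  by apply: (qm_sum qmQ) => j _; apply: simplex_module_X.
- by apply: (qmD qmQ); [exact: (qmC qmQ)|exact: simplex_module_X].
Qed.

Lemma simplex_positivity v : positivity_set simplex_module v ->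
  (forall i, 0 <= v i) /\ \sum_(i < n) v i = 1.
Proof.
move=> Qv; split=> [i|].
  by have := Qv _ (simplex_module_X i); rewrite mevalXU.
have := Qv _ (simplex_module_ideal 1); have := Qv _ (simplex_module_ideal (-1)).
rewrite mulN1r mul1r mevalN mevalB meval1 rmorph_sum /=.
by under eq_bigr do rewrite mevalXU; lra.
Qed.

End Simplex.

(** * Maximum stable sets and critical edges *)

Section StableSets.

Variables (n : nat) (e : rel 'I_n).
Hypothesis G_simple : simple_graph e.

Let e_sym : ssrbool.symmetric e. Proof. by case: G_simple. Qed.
Let e_irr : irreflexive e. Proof. by case: G_simple. Qed.

Definition neighbours (S : {set 'I_n}) i : {set 'I_n} := ([set j in S | e i j])%SET.

Lemma stableP (e' : rel 'I_n) (S : {set 'I_n}) :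
  reflect {in S &, forall i j, ~~ e' i j} (stable e' S).
Proof.
apply: (iffP forallP) => [H i j iS jS|H i].
  by have /implyP/(_ iS)/forallP/(_ j)/implyP/(_ jS) := H i.
by apply/implyP => iS; apply/forallP => j; apply/implyP => jS; apply: H.
Qed.

Lemma stable_card (e' : rel 'I_n) (S : {set 'I_n}) : stable e' S -> (#|S| <= alpha e')%N.
Proof. by move=> sS; apply: (leq_bigmax_cond (F := fun S : {set 'I_n} => #|S|)). Qed.

Lemma maximum_stable : exists S : {set 'I_n}, stable e S /\ #|S| = alpha e.
Proof.
have s0 : stable e finset.set0 by apply/stableP => i j; rewrite inE.
have [|S sS E] := @eq_bigmax_cond _ (stable e) (fun S : {set 'I_n} => #|S|).
  by apply/card_gt0P; exists finset.set0.
by exists S; split; [exact: sS|exact: esym E].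
Qed.

Lemma alpha_gt0 : (0 < n)%N -> (0 < alpha e)%N.
Proof.
move=> n0; have s1 : stable e [set Ordinal n0]%SET.
  by apply/stableP => i j; rewrite !inE => /eqP-> /eqP->; rewrite e_irr.
by have := stable_card s1; rewrite cards1.
Qed.

(** A set that is stable after the deletion becomes stable in the graph once [i] is removed from
    it. *)
Lemma alpha_del_edge i j : (alpha (del_edge e i j) <= (alpha e).+1)%N.
Proof.
apply/bigmax_leqP => T /stableP sT.
have sT' : stable e (T :\ i)%SET.
  apply/stableP => u w; rewrite !inE => /andP[ui uT] /andP[wi wT].
  have := sT _ _ uT wT; rewrite /del_edge negb_and negbK => /orP[//|/eqP H].
  have : i \in [set u; w]%SET by rewrite H !inE eqxx.
  by rewrite !inE eq_sym (negbTE ui) eq_sym (negbTE wi).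
have := stable_card sT'; rewrite (cardsD1 i T).
by case: (i \in T) => /= H; rewrite ?add1n ?ltnS // add0n leqW.
Qed.

(** With no neighbour in [S], [i] could be added to [S]. With a single neighbour [j], it could be
    added after deleting the edge [ij], which would be critical. *)
Lemma no_critical_neighbours (S : {set 'I_n}) i :
  (forall i j, ~~ critical_edge e i j) ->
  stable e S -> #|S| = alpha e -> i \notin S -> (2 <= #|neighbours S i|)%N.
Proof.
move=> ncrit /stableP sS cS iS; rewrite ltnNge; apply/negP.
rewrite leq_eqVlt ltnS leqn0 => /orP[/cards1P[j Nj]|].
  have [jS eij] : j \in S /\ e i j.
    by have : j \in neighbours S i; [rewrite Nj inE|rewrite inE => /andP[]].
  have /negP := ncrit i j; apply; rewrite /critical_edge eij /= eqn_leq alpha_del_edge.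
  suff /stable_card : stable (del_edge e i j) (i |: S)%SET by rewrite cardsU1 iS cS.
  have Ni k : k \in S -> ~~ del_edge e i j i k.
    move=> kS; rewrite /del_edge negb_and negbK.
    have [eik|//] := boolP (e i k).
    have : k \in neighbours S i by rewrite inE kS.
    by rewrite Nj inE => /eqP ->; rewrite eqxx.
  apply/stableP => u w; rewrite !inE => /orP[/eqP->|uS] /orP[/eqP->|wS].
  - by rewrite /del_edge e_irr.
  - exact: Ni.
  - have := Ni _ uS; rewrite /del_edge e_sym.
    by rewrite (_ : [set u; i]%SET = [set i; u]%SET) // finset.setUC.
  - by rewrite /del_edge (negbTE (sS _ _ uS wS)).
rewrite cards_eq0 => /eqP N0.
suff /stable_card : stable e (i |: S)%SET by rewrite cardsU1 iS cS ltnn.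
have Ni k : k \in S -> ~~ e i k.
  move=> kS; apply/negP => eik; have : k \in neighbours S i by rewrite inE kS.
  by rewrite N0 inE.
apply/stableP => u w; rewrite !inE => /orP[/eqP->|uS] /orP[/eqP->|wS].
- by rewrite e_irr.
- exact: Ni.
- by rewrite e_sym Ni.
- exact: sS.
Qed.

End StableSets.

(** * The theorem of Motzkin and Straus *)

Section MotzkinStraus.

Variables (R : realType) (n : nat) (e : rel 'I_n).
Hypothesis G_simple : simple_graph e.
Hypothesis n_gt0 : (0 < n)%N.

Let e_sym : ssrbool.symmetric e. Proof. by case: G_simple. Qed.
Let e_irr : irreflexive e. Proof. by case: G_simple. Qed.

(** The bilinear form of [I + A_G], over any commutative ring so that it applies to real points and
    to vectors of polynomials. *)
Definition graph_form (A : comPzRingType) (x y : 'I_n -> A) : A :=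
  \sum_(i < n) \sum_(j < n) ((i == j) + e i j)%:R * (x i * y j).

Lemma graph_formC (A : comPzRingType) (x y : 'I_n -> A) :
  graph_form x y = graph_form y x.
Proof.
rewrite /graph_form exchange_big; apply: eq_bigr => i _; apply: eq_bigr => j _ /=.
by rewrite eq_sym e_sym [x j * _]mulrC.
Qed.

Lemma graph_form_add (A : comPzRingType) (x y : 'I_n -> A) (c : A) :
  graph_form (fun i => x i + c * y i) (fun i => x i + c * y i) =
  graph_form x x + 2 * c * graph_form x y + c ^+ 2 * graph_form y y.
Proof.
have -> : 2 * c * graph_form x y = c * graph_form x y + c * graph_form y x.
  by rewrite (graph_formC y); ring.
rewrite /graph_form !mulr_sumr -!big_split; apply: eq_bigr => i _.
rewrite !mulr_sumr -!big_split; apply: eq_bigr => j _ /=.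
by ring.
Qed.

Lemma graph_formE (A : comPzRingType) (x y : 'I_n -> A) :
  graph_form x y = \sum_(i < n) x i * (y i + \sum_(j < n) (e i j)%:R * y j).
Proof.
apply: eq_bigr => i _; rewrite mulrDr mulr_sumr.
have -> : x i * y i = \sum_(j < n) (i == j)%:R * (x i * y j).
  rewrite (bigD1 i) //= eqxx mul1r big1 ?addr0 // => j ji.
  by rewrite eq_sym (negbTE ji) mul0r.
by rewrite -big_split; apply: eq_bigr => j _ /=; rewrite natrD; ring.
Qed.

Lemma graph_polyE : graph_poly R e = graph_form (fun i => 'X_i) (fun i => 'X_i).
Proof.
rewrite /graph_poly /graph_form; apply: eq_bigr => i _; apply: eq_bigr => j _.
rewrite !mxE -mul_mpolyC -natrD; congr (_ * _).
exact: (rmorph_nat (@mpolyC n R)).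
Qed.

Lemma meval_graph_poly (v : 'I_n -> R) : (graph_poly R e).@[v] = graph_form v v.
Proof.
rewrite graph_polyE rmorph_sum; apply: eq_bigr => i _.
rewrite rmorph_sum; apply: eq_bigr => j _.
by rewrite /= !mevalM !mevalXU rmorph_nat.
Qed.

Let t : R := (alpha e)%:R^-1.

Let alphaR_gt0 : 0 < (alpha e)%:R :> R.
Proof. by rewrite ltr0n; apply: alpha_gt0. Qed.

Let t_gt0 : 0 < t. Proof. by rewrite invr_gt0. Qed.

(** The point [x^S] when [S] is a maximum stable set; the common denominator [alpha e] makes all
    nonzero coordinates equal to [t]. *)
Definition barycentre (S : {set 'I_n}) (i : 'I_n) : R := (i \in S)%:R / (alpha e)%:R.

(** Coordinate [i] of [(I + A_G) x^S], that is, half a partial derivative of [f_G] at [x^S]. *)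
Lemma graph_form_barycentre S i : stable e S ->
  barycentre S i + \sum_(j < n) (e i j)%:R * barycentre S j =
  barycentre S i + #|neighbours e S i|%:R * t.
Proof.
move=> sS; congr (_ + _).
rewrite -sum1_card natr_sum mulr_suml [RHS]big_mkcond /=; apply: eq_bigr => j _.
rewrite inE /barycentre -/t; case: (j \in S); case: (e i j);
  by rewrite /= ?mul0r ?mulr0 ?mul1r.
Qed.

Lemma neighbours_stable (S : {set 'I_n}) i : stable e S -> i \in S -> #|neighbours e S i| = 0.
Proof.
move=> /stableP sS iS; apply/eqP; rewrite cards_eq0; apply/eqP/setP => j.
by rewrite !inE; apply/negP => /andP[jS]; apply/negP/sS.
Qed.

Lemma sum_barycentre (S : {set 'I_n}) (F : 'I_n -> R) :
  \sum_(i < n) barycentre S i * F i = t * \sum_(i in S) F i.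
Proof.
rewrite mulr_sumr [RHS]big_mkcond; apply: eq_bigr => i _.
by rewrite /barycentre -/t; case: (i \in S); rewrite ?mul1r // !mul0r.
Qed.

Lemma graph_form_barycentre_self (S : {set 'I_n}) : stable e S -> #|S| = alpha e ->
  graph_form (barycentre S) (barycentre S) = t.
Proof.
move=> sS cS; rewrite graph_formE sum_barycentre.
rewrite (eq_bigr (fun=> t)) => [|i iS].
  by rewrite sumr_const cS -[t *+ _]mulr_natr /t mulVf ?mulr1 // gt_eqF.
rewrite graph_form_barycentre // neighbours_stable // mul0r addr0.
by rewrite /barycentre iS mul1r.
Qed.

Let supp (v : 'I_n -> R) : {set 'I_n} := ([set i | v i != 0])%SET.

(** On a stable support the form is a sum of squares of coordinates, and completing the squares
    around [t] leaves two nonnegative corrections. If both vanish, [v] equals [t] on a support of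
    size [alpha e]. *)
Let motzkin_straus_stable (v : 'I_n -> R) :
  (forall i, 0 <= v i) -> \sum_i v i = 1 -> stable e (supp v) ->
  t <= graph_form v v /\ (graph_form v v = t ->
    exists S, [/\ stable e S, #|S| = alpha e & forall i, v i = barycentre S i]).
Proof.
move=> v0 v1 sv.
have -> : graph_form v v = \sum_(i in supp v) v i ^+ 2.
  rewrite graph_formE [RHS]big_mkcond; apply: eq_bigr => i _.
  rewrite inE; have [->|vi] := eqVneq (v i) 0; first by rewrite mul0r.
  rewrite expr2 big1 ?addr0 // => j _.
  have [->|vj] := eqVneq (v j) 0; first by rewrite mulr0.
  have /stableP/(_ i j) := sv; rewrite !inE vi vj => /(_ isT isT)/negbTE ->.
  by rewrite mul0r.
have {}v1 : \sum_(i in supp v) v i = 1.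
  rewrite -v1 [LHS]big_mkcond; apply: eq_bigr => i _.
  by rewrite inE; case: eqVneq.
have E : \sum_(i in supp v) v i ^+ 2 =
    t + \sum_(i in supp v) (v i - t) ^+ 2 + t * (1 - #|supp v|%:R * t).
  have -> : \sum_(i in supp v) (v i - t) ^+ 2 =
     \sum_(i in supp v) v i ^+ 2 - 2 * t * \sum_(i in supp v) v i + #|supp v|%:R * t ^+ 2.
    have -> : #|supp v|%:R * t ^+ 2 = \sum_(i in supp v) t ^+ 2.
      by rewrite sumr_const mulr_natl.
    by rewrite mulr_sumr -sumrB -big_split; apply: eq_bigr => i _ /=; ring.
  by rewrite v1; ring.
have sq0 : 0 <= \sum_(i in supp v) (v i - t) ^+ 2 by apply: sumr_ge0 => i _; exact: sqr_ge0.
have ct : #|supp v|%:R * t <= 1.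
  by rewrite ler_pdivrMr // mul1r ler_nat stable_card.
have ct0 : 0 <= t * (1 - #|supp v|%:R * t) by rewrite mulr_ge0 ?subr_ge0 // ltW.
split; first by rewrite E; lra.
rewrite E => E0; exists (supp v).
have /eqP : \sum_(i in supp v) (v i - t) ^+ 2 = 0 by lra.
rewrite psumr_eq0; last by move=> i _; exact: sqr_ge0.
move=> /allP H; have vt i : i \in supp v -> v i = t.
  move=> iv; have := H i (mem_index_enum _).
  by rewrite iv /= sqrf_eq0 subr_eq0 => /eqP.
have cv : #|supp v|%:R * t = 1.
  by rewrite -[RHS]v1 mulr_natl -sumr_const; apply: eq_bigr => i /vt.
split => // [|i].
  apply/eqP; rewrite -(eqr_nat R); apply/eqP.
  by apply: (mulIf (lt0r_neq0 t_gt0)); rewrite cv mulfV // gt_eqF.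
rewrite /barycentre -/t; have [iv|] := boolP (i \in supp v); first by rewrite mul1r vt.
by rewrite inE negbK mul0r => /eqP.
Qed.

Hypothesis no_critical : forall (S : {set 'I_n}) i,
  stable e S -> #|S| = alpha e -> i \notin S -> (2 <= #|neighbours e S i|)%N.

(* If the support of [v] contains an edge [ij], then the form is affine along
   the direction [e_i - e_j], so [v] can be replaced by the two points of smaller
   support in which [i], resp. [j], gives all its mass to the other one. *)
Theorem motzkin_straus (v : 'I_n -> R) :
  (forall i, 0 <= v i) -> \sum_i v i = 1 ->
  t <= graph_form v v /\ (graph_form v v = t ->
    exists S, [/\ stable e S, #|S| = alpha e & forall i, v i = barycentre S i]).
Proof.
have [k] := ubnP #|supp v|; elim: k v => // k IH v cv v0 v1.
have [sv|] := boolP (stable e (supp v)); first exact: motzkin_straus_stable.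
rewrite negb_forall => /existsP[i]; rewrite negb_imply => /andP[vi].
rewrite negb_forall => /existsP[j]; rewrite negb_imply negbK => /andP[vj eij].
have ij : i != j by apply: contraTneq eij => ->; rewrite e_irr.
have {}vi : 0 < v i by rewrite lt_neqAle eq_sym v0 andbT; rewrite inE in vi.
have {}vj : 0 < v j by rewrite lt_neqAle eq_sym v0 andbT; rewrite inE in vj.
pose d (l : 'I_n) : R := (l == j)%:R - (l == i)%:R.
pose w (c : R) l := v l + c * d l.
have sumd (F : 'I_n -> R) : \sum_l d l * F l = F j - F i.
  under eq_bigr => l _ do rewrite mulrBl.
  rewrite sumrB (bigD1 j) //= [X in _ - X](bigD1 i) //= !eqxx !mul1r.
  by rewrite !big1 ?addr0 // => l /negbTE ->; rewrite mul0r.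
have wE c : graph_form (w c) (w c) = graph_form v v + 2 * c * graph_form v d.
  rewrite graph_form_add; suff -> : graph_form d d = 0 by rewrite mulr0 addr0.
  have de l : \sum_k (e l k)%:R * d k = (e l j)%:R - (e l i)%:R.
    by rewrite -(sumd (fun k => (e l k)%:R)); apply: eq_bigr => k' _; rewrite mulrC.
  rewrite graph_formE sumd !de /d !eqxx !e_irr eij (negbTE ij) eq_sym (negbTE ij).
  by rewrite e_sym eij; ring.
have w_sum c : \sum_l w c l = 1.
  rewrite big_split /= v1 -mulr_sumr.
  by have := sumd (fun=> 1); under eq_bigr do rewrite mulr1; rewrite subrr => ->; rewrite mulr0 addr0.
have di : d i = -1 by rewrite /d eqxx (negbTE ij) sub0r.
have dj : d j = 1 by rewrite /d eqxx eq_sym (negbTE ij) subr0.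
have dl l : l != i -> l != j -> d l = 0 by rewrite /d => /negbTE -> /negbTE ->; rewrite subrr.
have w_ge0 c : - v j <= c -> c <= v i -> forall l, 0 <= w c l.
  move=> cj ci l; rewrite /w; have [->|li] := eqVneq l i; first by rewrite di; lra.
  have [->|lj] := eqVneq l j; first by rewrite dj; lra.
  by rewrite dl // mulr0 addr0.
have w_supp c l0 : v l0 != 0 -> w c l0 = 0 -> (forall l, v l = 0 -> w c l = 0) ->
    (#|supp (w c)| < k)%N.
  move=> vl0 wl0 H; rewrite -ltnS; apply: leq_trans cv; rewrite ltnS.
  apply: proper_card; apply/properP; split.
    by apply/fintype.subsetP => l; rewrite !inE; apply: contraNneq => /H ->.
  by exists l0; rewrite !inE // wl0 eqxx.
have w_v0 c l : v l = 0 -> w c l = 0.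
  move=> vl; have li : l != i by apply: contraTneq vi => <-; rewrite vl ltxx.
  have lj : l != j by apply: contraTneq vj => <-; rewrite vl ltxx.
  by rewrite /w vl add0r dl ?mulr0.
have [| |ge1 eq1] := IH (w (v i)) _ _ (w_sum _).
- by apply: (w_supp _ i); [rewrite gt_eqF|rewrite /w di; lra|exact: w_v0].
- by apply: w_ge0 => //; lra.
have [| |ge2 eq2] := IH (w (- v j)) _ _ (w_sum _).
- by apply: (w_supp _ j); [rewrite gt_eqF|rewrite /w dj; lra|exact: w_v0].
- by apply: w_ge0 => //; lra.
move: ge1 eq1 ge2 eq2; rewrite !wE; move: (graph_form v v) (graph_form v d) => q b.
move=> ge1 eq1 ge2 eq2.
(* A function affine in [c] is at least [t] at [v i > 0] and at [- v j < 0], hence at 0. Equality at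
   0 forces the slope to vanish, so that both end points attain [t] as well. *)
have qt : t <= q by nra.
split=> // qE; have b0 : b = 0 by subst q; nra.
have [S1 [sS1 cS1 wS1]] : exists S, [/\ stable e S, #|S| = alpha e &
  forall l, w (v i) l = barycentre S l] by apply: eq1; rewrite b0 qE; lra.
have [S2 [sS2 cS2 wS2]] : exists S, [/\ stable e S, #|S| = alpha e &
  forall l, w (- v j) l = barycentre S l] by apply: eq2; rewrite b0 qE; lra.
have memS S l : (0 < barycentre S l) = (l \in S).
  by rewrite /barycentre -/t; case: (l \in S); rewrite ?mul1r ?t_gt0 // mul0r ltxx.
have iS1 : i \notin S1 by rewrite -memS -wS1 /w di mulrN1 subrr ltxx.
have iS2 : i \in S2 by rewrite -memS -wS2 /w di; lra.
(* [S1] and [S2] agree off [i] and [j], and [i] is in [S2]; stability of [S2] leaves [j] as the only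
   possible neighbour of [i] in [S1]. *)
have : (#|neighbours e S1 i| <= #|[set j]%SET|)%N.
  apply/subset_leq_card/fintype.subsetP => l; rewrite !inE => /andP[lS1 eil].
  apply: contraT => lj; have li : l != i by apply: contraTneq eil => ->; rewrite e_irr.
  have lS2 : l \in S2 by move: lS1; rewrite -!memS -wS1 -wS2 /w dl // !mulr0.
  by have /stableP/(_ _ _ iS2 lS2) := sS2; rewrite eil.
rewrite cards1 => le1; have := no_critical sS1 cS1 iS1.
by rewrite ltnNge le1.
Qed.

End MotzkinStraus.

(** * The certificate of a graph without critical edges *)

Section Certificate.

Variables (R : realType) (n : nat) (e : rel 'I_n).
Hypothesis G_simple : simple_graph e.
Hypothesis n_gt0 : (0 < n)%N.
Hypothesis no_critical : forall (S : {set 'I_n}) i,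
  stable e S -> #|S| = alpha e -> i \notin S -> (2 <= #|neighbours e S i|)%N.

Let t : R := (alpha e)%:R^-1.

Let t_gt0 : 0 < t.
Proof. by rewrite invr_gt0 ltr0n; apply: alpha_gt0. Qed.

Let f : {mpoly R[n]} := graph_poly R e - t%:MP.

(** * Expansion at the barycentre of a maximum stable set *)

Section Local.

Variable S : {set 'I_n}.
Hypotheses (S_stable : stable e S) (S_max : #|S| = alpha e).

Let a (i : 'I_n) : {mpoly R[n]} := (barycentre R e S i)%:MP.
Let g (i : 'I_n) : {mpoly R[n]} := 'X_i - a i.
Let d i := #|neighbours e S i|.
(** Seen from [i] outside [S], an edge into [S] is charged to [i] alone, hence twice; an edge
    outside [S] is charged once to each end. *)
Let b i j : R := (e i j)%:R * (1 + (j \in S)%:R).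

Let barycentreC i : a i + \sum_(j < n) (e i j)%:R * a j = a i + ((d i)%:R * t)%:MP.
Proof.
have := congr1 (@mpolyC n R) (graph_form_barycentre R i S_stable).
rewrite !rmorphD rmorph_sum /= => <-; congr (_ + _); apply: eq_bigr => j _.
by rewrite mpolyCM rmorph_nat.
Qed.

Let graph_form_aa : graph_form e a a = t%:MP.
Proof.
rewrite /t -(graph_form_barycentre_self R G_simple n_gt0 S_stable S_max) /graph_form.
rewrite rmorph_sum; apply: eq_bigr => i _; rewrite rmorph_sum; apply: eq_bigr => j _.
by rewrite /= 2!mpolyCM rmorph_nat.
Qed.

Let a_out i : i \notin S -> a i = 0.
Proof. by move=> /negbTE iS; rewrite /a /barycentre iS mul0r mpolyC0. Qed.

(** The coefficient of [g i] is [t] on [S] and [d i] times [t] outside. Splitting off [t] everywhere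
    gives the multiple of [1 - sum x_i]. *)
Let graph_form_ga : graph_form e g a = \sum_(i | i \notin S) (((d i)%:R - 1) * t)%:MP * 'X_i
  + (- t)%:MP * (1 - \sum_(i < n) 'X_i).
Proof.
rewrite graph_formE.
have -> : \sum_i g i * (a i + \sum_j (e i j)%:R * a j) =
   \sum_i (t%:MP * g i + if i \notin S then (((d i)%:R - 1) * t)%:MP * 'X_i else 0).
  apply: eq_bigr => i _; rewrite barycentreC.
  have [iS|iS] := boolP (i \in S) => /=.
    rewrite /d (neighbours_stable S_stable iS) mul0r mpolyC0 !addr0 mulrC.
    by rewrite /a /barycentre iS mul1r.
  by rewrite /g a_out // subr0; ring.
rewrite big_split /= -big_mkcond /= -mulr_sumr addrC; congr (_ + _).
have -> : \sum_i g i = \sum_i 'X_i - \sum_i a i by rewrite -sumrB.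
have -> : \sum_i a i = 1.
  rewrite -mpolyC1 -[in RHS](_ : \sum_i barycentre R e S i = 1) ?rmorph_sum //.
  have := sum_barycentre e S (fun=> 1 : R).
  under eq_bigr do rewrite mulr1.
  by move=> ->; rewrite sumr_const S_max mulVf // pnatr_eq0 -lt0n alpha_gt0.
ring.
Qed.

(** Every edge has an end [i] outside the stable set [S], where [g i] is ['X_i]. *)
Let graph_form_gg : graph_form e g g = sqdist (barycentre R e S)
  + \sum_(i | i \notin S) 'X_i * \sum_j (b i j)%:MP * g j.
Proof.
rewrite graph_formE.
under eq_bigr => i _ do rewrite mulrDr.
rewrite big_split /=; congr (_ + _).
pose E i j : {mpoly R[n]} := (e i j)%:R * (g i * g j).
have -> : \sum_i g i * \sum_j (e i j)%:R * g j = \sum_i \sum_j E i j.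
  apply: eq_bigr => i _; rewrite mulr_sumr; apply: eq_bigr => j _.
  by rewrite /E; ring.
have Esym i j : E i j = E j i.
  by rewrite /E; case: G_simple => -> _; rewrite [g i * _]mulrC.
have E0 i j : i \in S -> j \in S -> E i j = 0.
  by move=> iS jS; rewrite /E (negbTE (stableP _ _ S_stable i j iS jS)) mul0r.
have -> : \sum_(i | i \notin S) 'X_i * (\sum_j (b i j)%:MP * g j) =
    \sum_(i | i \notin S) (\sum_j E i j + \sum_(j in S) E i j).
  apply: eq_bigr => i iS; rewrite [X in _ + X]big_mkcond -big_split mulr_sumr.
  apply: eq_bigr => j _; rewrite /E /b {2 4}/g a_out // subr0 /=.
  rewrite mpolyCM mpolyCD !rmorph_nat mpolyC1.
  by case: (j \in S); rewrite /=; ring.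
rewrite [LHS](bigID (fun i => i \in S)) /= big_split /= addrC; congr (_ + _).
rewrite [RHS]exchange_big /=; apply: eq_bigr => i iS.
rewrite (bigID (fun j => j \in S)) /= big1 ?add0r => [|j jS]; last exact: E0.
by apply: eq_bigr => j _.
Qed.

(** The constant [c] is shared equally among the coordinates and each square is completed; this
    needs [K >= F j ^+ 2 * n / (4 c)]. *)
Let sos_lin (c K : R) (F : 'I_n -> R) : 0 < c -> n%:R / c <= K ->
  (forall j, `|F j| <= 2) ->
  sos (c%:MP + \sum_j (F j)%:MP * g j + K%:MP * sqdist (barycentre R e S)).
Proof.
move=> c0 cK F2; have nR : 0 < n%:R :> R by rewrite ltr0n.
pose c' := c / n%:R; have c'0 : 0 < c' by rewrite divr_gt0.
have -> : c%:MP + \sum_j (F j)%:MP * g j + K%:MP * sqdist (barycentre R e S) =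
   \sum_j (c'%:MP + (F j)%:MP * g j + K%:MP * g j ^+ 2).
  rewrite !big_split /= -mulr_sumr; congr (_ + _ + _).
  rewrite sumr_const card_ord -mpolyCMn; congr (_%:MP).
  by rewrite -mulr_natr /c' mulfVK // gt_eqF.
apply: sos_sum => j _.
have -> : c'%:MP + (F j)%:MP * g j + K%:MP * g j ^+ 2 =
   c'%:MP * (1 + (F j / (2 * c'))%:MP * g j) ^+ 2 + (K - F j ^+ 2 / (4 * c'))%:MP * g j ^+ 2.
  set z := F j / (2 * c').
  have -> : F j = 2 * c' * z by rewrite /z; field; rewrite gt_eqF.
  have -> : (2 * c' * z) ^+ 2 / (4 * c') = c' * z ^+ 2 by field; rewrite gt_eqF.
  by ring.
apply: sosD; apply: sosM (sos_sqr _); apply: sosC; first exact: ltW.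
rewrite subr_ge0; apply: le_trans cK.
rewrite ler_pdivrMr; last by rewrite mulr_gt0.
have -> : n%:R / c * (4 * c') = 4 by rewrite /c'; field; rewrite !gt_eqF.
have := F2 j; rewrite ler_norml => /andP[]; nra.
Qed.

(** Adding [K D_S] to the affine cofactor of each ['X_i] makes it a sum of squares. The compensation
    goes into [k], which is 1 at the barycentre because the ['X_i] outside [S] vanish there. *)
Lemma graph_poly_local : exists2 k : {mpoly R[n]}, 0 < k.@[barycentre R e S] &
  simplex_module (f - sqdist (barycentre R e S) * k).
Proof.
have qmQ := simplex_module_qm R n.
(* As [d i >= 2] outside [S], the constants [2 (d i - 1) t] are at least [2 t], so one [K] serves
   all [i]. *)
pose K := n%:R / (2 * t).
exists (1 - K%:MP * \sum_(i | i \notin S) 'X_i).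
  rewrite mevalB meval1 mevalM rmorph_sum /= big1 ?mulr0 ?subr0 ?ltr01 // => i iS.
  by rewrite mevalXU /barycentre (negbTE iS) mul0r.
have -> : f - sqdist (barycentre R e S) * (1 - K%:MP * \sum_(i | i \notin S) 'X_i) =
    \sum_(i | i \notin S) ((2 * ((d i)%:R - 1) * t)%:MP + \sum_j (b i j)%:MP * g j
      + K%:MP * sqdist (barycentre R e S)) * 'X_i
    + (- (2 * t))%:MP * (1 - \sum_(i < n) 'X_i).
  have -> : f = graph_form e (fun i => a i + 1 * g i) (fun i => a i + 1 * g i) - t%:MP.
    rewrite /f graph_polyE; congr (_ - _); rewrite /graph_form.
    by do 2!(apply: eq_bigr => ? _); rewrite /g !mul1r ![a _ + _]addrC !subrK.
  rewrite graph_form_add // graph_form_aa (graph_formC G_simple) graph_form_ga graph_form_gg.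
  set D := sqdist _; set P := 1 - \sum_i _.
  have -> : \sum_(i | i \notin S) ((2 * ((d i)%:R - 1) * t)%:MP + \sum_j (b i j)%:MP * g j + K%:MP * D) * 'X_i =
     2 * \sum_(i | i \notin S) (((d i)%:R - 1) * t)%:MP * 'X_i
     + \sum_(i | i \notin S) 'X_i * (\sum_j (b i j)%:MP * g j)
     + K%:MP * D * \sum_(i | i \notin S) 'X_i.
    rewrite !mulr_sumr -!big_split /=; apply: eq_bigr => i _.
    by rewrite -mulrA mpolyCM (rmorph_nat (@mpolyC n R)); ring.
  by rewrite mpolyCN mpolyCM (rmorph_nat (@mpolyC n R)); ring.
apply: (qmD qmQ); last exact: simplex_module_ideal.
apply: (qm_sum qmQ) => i iS; apply: (qm_sosM qmQ); last exact: simplex_module_X.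
have d2 : 2 <= (d i)%:R :> R by rewrite ler_nat; apply: no_critical.
have c0 : 0 < 2 * ((d i)%:R - 1) * t by rewrite !mulr_gt0 // subr_gt0; lra.
have bF j : `|b i j| <= 2.
  by rewrite /b; case: (e i j); case: (j \in S); rewrite /= ger0_norm ?mul1r ?mul0r; lra.
apply: sos_lin => //.
rewrite /K ler_pM2l ?ltr0n // lef_pV2 ?posrE ?mulr_gt0 //; last by lra.
by rewrite ler_pM2r //; lra.
Qed.

End Local.

Theorem graph_poly_certificate : simplex_module f.
Proof.
pose maxS := {S : {set 'I_n} | stable e S && (#|S| == alpha e)}.
have maxSP (S : maxS) : stable e (val S) /\ #|val S| = alpha e.
  by case/andP: (valP S) => ? /eqP.
have fE v : f.@[v] = graph_form e v v - t by rewrite mevalB mevalC meval_graph_poly.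
apply: (@local_global R n (@simplex_module R n) maxS (fun S => barycentre R e (val S))).
- exact: simplex_module_qm.
- exact: simplex_module_archimedean.
- move=> S T ST; apply/val_inj/setP => i.
  have := ST i; rewrite /barycentre => /mulIf; rewrite invr_eq0 pnatr_eq0 -lt0n alpha_gt0 //.
  move=> /(_ isT)/eqP; rewrite eqr_nat.
  by case: (i \in val S); case: (i \in val T).
- move=> v /simplex_positivity[v0 v1]; rewrite fE subr_ge0.
  by have [] := motzkin_straus G_simple n_gt0 no_critical v0 v1.
- move=> v /simplex_positivity[v0 v1] /eqP; rewrite fE subr_eq0 => /eqP vt.
  have [_ /(_ vt)[S [sS cS vS]]] := motzkin_straus G_simple n_gt0 no_critical v0 v1.
  have SP : stable e S && (#|S| == alpha e) by rewrite sS cS eqxx.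
  by exists (Sub S SP) => j; rewrite SubK.
- by move=> S; have [sS cS] := maxSP S; apply: graph_poly_local.
Qed.

End Certificate.

(** * The two hierarchies *)

Section Bounds.

Variables (R : realType) (n : nat) (e : rel 'I_n).
Hypothesis G_simple : simple_graph e.
Hypothesis n_gt0 : (0 < n)%N.

(** A certificate for [l] is evaluated at the barycentre of a maximum stable set, a point of the
    simplex where [f_G] is [1 / alpha]. *)
Lemma f_bound_le (r : nat) : (f_bound R e r <= ((alpha e)%:R^-1)%:E)%E.
Proof.
apply: ge_ereal_sup => _ [l [p [q [[s0 [s [[ss0 ss] _ _ ->]]] [u _ ->] E]]] <-].
rewrite lee_fin; have [S [sS cS]] := maximum_stable e.
pose v := barycentre R e S.
have v0 i : 0 <= v i by rewrite /v /barycentre divr_ge0.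
have v1 : \sum_i v i = 1.
  have := sum_barycentre e S (fun=> 1 : R); under eq_bigr do rewrite mulr1.
  by move=> ->; rewrite sumr_const cS mulVf // pnatr_eq0 -lt0n alpha_gt0.
have := congr1 (meval v) E.
rewrite mevalB mevalC meval_graph_poly graph_form_barycentre_self //.
rewrite !mevalD mevalM mevalB meval1 !rmorph_sum /=.
have -> : \sum_i ('X_i : {mpoly R[n]}).@[v] = 1.
  by rewrite -[RHS]v1; apply: eq_bigr => i _; rewrite mevalXU.
rewrite subrr mulr0 addr0 => Ev; rewrite -subr_ge0 Ev addr_ge0 ?sos_ge0 //.
by apply: sumr_ge0 => j _; rewrite mevalM mevalXU mulr_ge0 // sos_ge0.
Qed.

Lemma f_bound_certificate : simplex_module (graph_poly R e - ((alpha e)%:R^-1)%:MP) ->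
  exists2 r : nat, (1 <= r)%N & f_bound R e r = ((alpha e)%:R^-1)%:E.
Proof.
move=> [s0 [s [u [ss0 ss E]]]].
pose h : {mpoly R[n]} := 1 - \sum_(i < n) 'X_i.
(* At least the size of every term of the certificate, and at least 1. *)
pose r := maxn 1 (maxn (msize s0) (maxn (\max_(j < n) msize (s j * 'X_j)) (msize (u * h)))).
exists r; first by rewrite leq_max.
apply/le_anti; rewrite f_bound_le /=.
apply: ereal_sup_ubound; exists (alpha e)%:R^-1 => //.
have deg p : (msize p <= r)%N -> deg_le (2 * r) p.
  by move=> pr; rewrite /deg_le; apply: leq_trans pr _; rewrite leqW // leq_pmull.
exists (s0 + \sum_(j < n) s j * 'X_j), (u * h); split.
- exists s0, s; split => //.
  + by apply: deg; rewrite !leq_max leqnn ?orbT.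
  + move=> j; apply: deg; rewrite !leq_max; apply/or3P; apply: Or33; apply/orP; left.
    exact: (leq_bigmax (F := fun j => msize (s j * 'X_j))).
- by exists u => //; apply: deg; rewrite !leq_max leqnn !orbT.
- exact: E.
Qed.

(** At the indicator vector of a maximum stable set, the sum of squares is a positive multiple of
    [x alpha - alpha^2]. *)
Lemma theta_ge (r : nat) (x : R) :
  cone_K r (x *: (1%:M + adjacency R e) - const_mx 1) -> (alpha e)%:R <= x.
Proof.
move=> [_ /sos_ge0 H]; have [S [sS cS]] := maximum_stable e.
have a0 : 0 < (alpha e)%:R :> R by rewrite ltr0n alpha_gt0.
pose v (i : 'I_n) : R := (i \in S)%:R.
have v2 i : v i ^+ 2 = v i by rewrite /v; case: (i \in S); rewrite ?expr1n ?expr0n.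
have sumv : \sum_i v i = (alpha e)%:R by rewrite /v -natr_sum -big_mkcond sum1_card cS.
have := H v; rewrite mevalM rmorphXn /= !rmorph_sum /=.
have -> : \sum_i (('X_i ^+ 2 : {mpoly R[n]})).@[v] = (alpha e)%:R.
  by rewrite -sumv; apply: eq_bigr => i _; rewrite rmorphXn /= mevalXU v2.
rewrite pmulr_rge0 ?exprn_gt0 //.
have -> : \sum_i (\sum_j (x *: (1%:M + adjacency R e) - const_mx 1) i j *:
     ('X_i ^+ 2 * 'X_j ^+ 2) : {mpoly R[n]}).@[v] = x * graph_form e v v - (\sum_i v i) ^+ 2.
  rewrite expr2 mulr_suml mulr_sumr -sumrB; apply: eq_bigr => i _.
  rewrite rmorph_sum !mulr_sumr -sumrB; apply: eq_bigr => j _.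
  rewrite /= mevalZ mevalM !rmorphXn /= !mevalXU !v2 !mxE natrD; ring.
have -> : graph_form e v v = (alpha e)%:R.
  rewrite -sumv graph_formE; apply: eq_bigr => i _.
  have [iS|iS] := boolP (i \in S); last by rewrite /v (negbTE iS) mul0r.
  rewrite big1 ?addr0 -?expr2 ?v2 // => j _.
  have [jS|jS] := boolP (j \in S); last by rewrite /v (negbTE jS) mulr0.
  by rewrite (negbTE (stableP _ _ sS _ _ iS jS)) mul0r.
by rewrite sumv subr_ge0 expr2 ler_pM2r.
Qed.

Let X2 : {mpoly R[n]} := \sum_(i < n) 'X_i ^+ 2.

Let X2_sos : sos X2.
Proof. by apply: sos_sum => i _; exact: sos_sqr. Qed.

Let X2_neq0 : X2 != 0.
Proof.
apply/eqP => /(congr1 (meval (fun=> 1))); rewrite meval0 rmorph_sum /= => /eqP.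
rewrite psumr_eq0 => [/allP/(_ (Ordinal n_gt0) (mem_index_enum _))|i _].
  by rewrite rmorphXn /= mevalXU expr1n oner_eq0.
by rewrite rmorphXn /= sqr_ge0.
Qed.

(** * Substitution into the fraction field and clearing of denominators *)

Section Homogenization.

Variables (K : fieldType) (frac ev : {rmorphism {mpoly R[n]} -> K}).
Hypothesis frac_inj : injective frac.
Hypothesis evX : forall i, ev 'X_i = frac ('X_i ^+ 2) / frac X2.
Hypothesis evC : forall c, ev c%:MP = frac c%:MP.

Let frac_X2 : frac X2 != 0.
Proof. by rewrite -(rmorph0 frac) (inj_eq frac_inj). Qed.

(* Clearing denominators in [ev] amounts to homogenizing. *)
Let has_sos_numerator (p : {mpoly R[n]}) :=
  exists D q, sos q /\ ev p * frac X2 ^+ D = frac q.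

Let numeratorD p q : has_sos_numerator p -> has_sos_numerator q -> has_sos_numerator (p + q).
Proof.
move=> [D [p' [sp Ep]]] [D' [q' [sq Eq]]].
exists (D + D')%N, (p' * X2 ^+ D' + q' * X2 ^+ D); split.
  by apply: sosD; apply: sosM => //; apply: sosX.
by rewrite !(rmorphD, rmorphM, rmorphXn) /= -Ep -Eq exprD; ring.
Qed.

Let numeratorM p q : has_sos_numerator p -> has_sos_numerator q -> has_sos_numerator (p * q).
Proof.
move=> [D [p' [sp Ep]]] [D' [q' [sq Eq]]].
exists (D + D')%N, (p' * q'); split; first exact: sosM.
by rewrite !(rmorphM, rmorphXn) /= -Ep -Eq exprD; ring.
Qed.

Let numeratorX i : has_sos_numerator 'X_i.
Proof.
exists 1, ('X_i ^+ 2); split; first exact: sos_sqr.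
by rewrite evX expr1 mulfVK.
Qed.

Let numerator_exists p : exists D q, ev p * frac X2 ^+ D = frac q.
Proof.
elim/mpoly_ring_ind: p => [c|i|p q [D [p' Ep]] [D' [q' Eq]]|p q [D [p' Ep]] [D' [q' Eq]]].
- by exists 0, c%:MP; rewrite expr0 mulr1 evC.
- by have [D [q [_ Eq]]] := numeratorX i; exists D, q.
- exists (D + D')%N, (p' * X2 ^+ D' + q' * X2 ^+ D).
  by rewrite !(rmorphD, rmorphM, rmorphXn) /= -Ep -Eq exprD; ring.
- by exists (D + D')%N, (p' * q'); rewrite !rmorphM /= -Ep -Eq exprD; ring.
Qed.

Let numerator_sos s : sos s -> has_sos_numerator s.
Proof.
move=> [l ->]; apply: (big_ind has_sos_numerator) => [||q _]; last 1 first.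
- have [D [q' Eq]] := numerator_exists q.
  exists D.*2, (q' ^+ 2); split; first exact: sos_sqr.
  by rewrite !rmorphXn /= -Eq exprMn -exprM muln2.
- by exists 0, 0; split; [exact: sos0|rewrite !rmorph0 mul0r].
- exact: numeratorD.
Qed.

(** [ev] kills [1 - sum x_i], and the rest of the certificate has a numerator [q] that is a sum of
    squares, over [X2 ^+ D]. Clearing also the denominator [X2 ^+ 2] of the form leaves
    [q * X2 ^+ 2], still a sum of squares, so the order is [D]. *)
Lemma homogeneous_certificate : simplex_module (graph_poly R e - ((alpha e)%:R^-1)%:MP) ->
  exists r : nat, theta_eq e r ((alpha e)%:R : R).
Proof.
move=> [s0 [s [u [ss0 ss E]]]].
have a0 : 0 < (alpha e)%:R :> R by rewrite ltr0n alpha_gt0.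
have [D [q [sq Eq]]] : has_sos_numerator (s0 + \sum_(j < n) s j * 'X_j).
  apply: numeratorD; first exact: numerator_sos.
  apply: (big_ind has_sos_numerator) => [||j _].
  - exact/numerator_sos/sos0.
  - exact: numeratorD.
  - by apply: numeratorM; [exact: numerator_sos|exact: numeratorX].
exists D; split; last by move=> x; exact: theta_ge.
split.
  apply/matrixP => i j; rewrite !mxE eq_sym.
  by case: G_simple => -> _.
pose g := \sum_(i < n) \sum_(j < n) ((i == j) + e i j)%:R * ('X_i ^+ 2 * 'X_j ^+ 2) : {mpoly R[n]}.
have -> : \sum_i \sum_j ((alpha e)%:R *: (1%:M + adjacency R e) - const_mx 1) i j *:
    ('X_i ^+ 2 * 'X_j ^+ 2) = (alpha e)%:R%:MP * (g - ((alpha e)%:R^-1)%:MP * X2 ^+ 2).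
  have -> : (alpha e)%:R%:MP * (g - ((alpha e)%:R^-1)%:MP * X2 ^+ 2) =
    (alpha e)%:R%:MP * g - X2 ^+ 2.
    by rewrite mulrBr mulrA -mpolyCM divff ?gt_eqF // mpolyC1 mul1r.
  rewrite /X2 expr2 mulr_suml mulr_sumr -sumrB; apply: eq_bigr => i _.
  rewrite !mulr_sumr -sumrB; apply: eq_bigr => j _.
  rewrite !mxE -mul_mpolyC -natrD mpolyCB mpolyCM mpolyC1.
  by rewrite (rmorph_nat (@mpolyC n R) ((i == j) + e i j)); ring.
rewrite mulrCA; apply: sosM; first exact/sosC/ltW.
suff -> : X2 ^+ D * (g - ((alpha e)%:R^-1)%:MP * X2 ^+ 2) = q * X2 ^+ 2.
  by apply: sosM => //; apply: sosX.
apply/frac_inj; rewrite !(rmorphM, rmorphXn, rmorphB) /= -Eq.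
have -> : ev (s0 + \sum_(j < n) s j * 'X_j) = ev (graph_poly R e - ((alpha e)%:R^-1)%:MP).
  rewrite E [RHS]rmorphD [X in _ = _ + X]rmorphM /= [ev (1 - _)](_ : _ = 0) ?mulr0 ?addr0 //.
  rewrite rmorphB rmorph1 rmorph_sum /=.
  under eq_bigr do rewrite evX.
  by rewrite -mulr_suml -rmorph_sum divff ?subrr.
have -> : ev (graph_poly R e - ((alpha e)%:R^-1)%:MP) =
    frac g / frac X2 ^+ 2 - frac ((alpha e)%:R^-1)%:MP.
  rewrite rmorphB /= evC; congr (_ - _).
  move: (frac X2) frac_X2 evX => y y0 evX'.
  rewrite graph_polyE /g !rmorph_sum mulr_suml; apply: eq_bigr => i _ /=.
  rewrite !rmorph_sum mulr_suml; apply: eq_bigr => j _ /=.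
  by rewrite !rmorphM !rmorph_nat /= !evX' !rmorphXn /=; field.
by move: (frac X2) frac_X2 (frac _%:MP) => y y0 c; field.
Qed.

End Homogenization.

Lemma theta_certificate : simplex_module (graph_poly R e - ((alpha e)%:R^-1)%:MP) ->
  exists r : nat, theta_eq e r ((alpha e)%:R : R).
Proof.
pose frac : {rmorphism {mpoly R[n]} -> {fraction {mpoly R[n]}}} := @tofrac {mpoly R[n]}.
pose onK : {rmorphism R -> {fraction {mpoly R[n]}}} := frac \o @mpolyC n R.
pose ev : {rmorphism {mpoly R[n]} -> {fraction {mpoly R[n]}}} :=
  mmap onK (fun i => frac ('X_i ^+ 2) / frac X2).
apply: (@homogeneous_certificate _ frac ev) => [|i|c].
- by move=> p q /eqP; rewrite /= tofrac_eq => /eqP.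
- by rewrite /= mmapX mmap1U.
- by rewrite /= mmapC.
Qed.

End Bounds.

Theorem corollary5p2 (R : realType) (n : nat) (n_gt0 : (0 < n)%N)
    (e : rel 'I_n) (G_simple : simple_graph e)
    (no_critical : forall i j : 'I_n, ~~ critical_edge e i j) :
  (exists2 r : nat, (1 <= r)%N & f_bound R e r = ((alpha e)%:R^-1)%:E) /\
  (exists r : nat, theta_eq e r ((alpha e)%:R : R)).
Proof.
have certificate : simplex_module (graph_poly R e - ((alpha e)%:R^-1)%:MP).
  apply: graph_poly_certificate => // S i sS cS iS.
  exact: no_critical_neighbours.
by split; [exact: f_bound_certificate|exact: theta_certificate].
Qed.
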